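(* Let $A\neq 0$ and $B\ge 0$ be real numbers, and consider the arc-length parametrized curves $X:\mathbf R\to\mathbf C$ satisfying $$A\langle X,T\rangle + B\langle X,N\rangle = k \quad\text{on } \mathbf R .$$ Then the following hold. (i) Every such curve $X$ is properly embedded, has exactly one point closest to the origin, and consists of two arms coming out from this point, along each of which the distance to the origin strictly increases to infinity. Each arm has infinite total curvature (the integral of $k\,ds$ along the arm diverges to $+\infty$ or $-\infty$) and spirals infinitely many circles around the origin (a continuous determination of the polar angle of $X$ along the arm tends to $+\infty$ or $-\infty$). The curvature $k$ tends to $0$ along each arm, and the limiting growing direction of each arm is $B+iA$ times the location, i.e. if $T_{\mathrm{out}}$ denotes the unit tangent along the arm pointing in the direction of travel towards infinity, then $$\frac{|X|\,T_{\mathrm{out}}}{X}\longrightarrow \frac{B+iA}{\sqrt{A^2+B^2}}$$ along the arm. (ii) The curves form a one-dimensional family parametrized by their distance to the origin, which can take on any value in $[0,\infty)$: for every $d\in[0,\infty)$ there is, up to rotation about the origin and reparametrization, exactly one such curve with $\min|X|=d$. (iii) If $B=0$, then under the curve shortening flow the curve rotates forever with constant angular speed $A$, i.e. $\hat X(u,t)=e^{iAt}X(u)$, $t\ge 0$, is the curve shortening flow of $X$ (up to tangential diffeomorphisms). (iv) If $B>0$, then under the curve shortening flow the curve rotates and expands forever with angular function $f(t)=\frac{A}{2B}\log(2Bt+1)$ and scaling function $g(t)=\sqrt{2Bt+1}$, i.e. $\hat X(u,t)=g(t)e^{if(t)}X(u)$, $t\ge0$, is the curve shortening flow of $X$ (up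 to tangential diffeomorphisms).
   Context: The plane is identified with $\mathbf C$, with the real inner product $\langle z,w\rangle=\mathrm{Re}(z\bar w)$. Curves are smooth, defined on all of $\mathbf R$ and parametrized by arc length ($|X'|=1$). $T=X'$ is the unit tangent, $N=iT$ the leftward pointing normal, and $k=\langle X'',N\rangle$ the signed curvature. A family $\hat X(u,t)$ of immersed curves with $\hat X(u,0)=X(u)$ is the curve shortening flow of $X$ (up to tangential diffeomorphisms) if $\langle \partial_t\hat X(u,t),N(u,t)\rangle=k(u,t)$ for all $(u,t)$, where $N(u,t)$ and $k(u,t)$ are the leftward normal and signed curvature of the curve $u\mapsto\hat X(u,t)$. *)

(* Defs.v *)
From Stdlib Require Import Reals List.
From Coquelicot Require Import Coquelicot.
Open Scope R_scope.

Definition dot (z w : C) : R := Re (z * Cconj w)%C.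

Definition expi (theta : R) : C := (cos theta, sin theta).

Definition smooth_fun (f : R -> R) : Prop :=
  forall (n : nat) (u : R), ex_derive_n f n u.

Definition smooth (c : R -> C) : Prop :=
  smooth_fun (fun u => Re (c u)) /\ smooth_fun (fun u => Im (c u)).

(* Coquelicot's [Derive] is for real-valued functions only. *)
Definition deriveC (c : R -> C) (u : R) : C :=
  (Derive (fun v => Re (c v)) u, Derive (fun v => Im (c v)) u).

Definition immersed (c : R -> C) : Prop :=
  smooth c /\ forall u, deriveC c u <> 0%C.

Definition unit_speed (c : R -> C) : Prop :=
  forall u, Cmod (deriveC c u) = 1.

(* Derivative of [f] along the curve [c] with respect to the arc length
   parameter [s] of [c], that is [|c'|^-1 d/du]. *)
Definition arc_derive (c f : R -> C) (u : R) : C :=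
  (deriveC f u / Cmod (deriveC c u))%C.

Definition tangent (c : R -> C) : R -> C := arc_derive c c.

Definition normal (c : R -> C) (u : R) : C := (Ci * tangent c u)%C.

(* [<c_ss, N>] for an arbitrary immersed curve: the time slices of a flow need
   not be parametrized by arc length. *)
Definition curvature (c : R -> C) (u : R) : R :=
  dot (arc_derive c (tangent c) u) (normal c u).

Lemma tangent_unit_speed (c : R -> C) :
  unit_speed c -> forall u, tangent c u = deriveC c u.
Proof.
intros Hc u; unfold tangent, arc_derive; rewrite Hc; field.
Qed.

Lemma curvature_unit_speed (c : R -> C) :
  unit_speed c ->
  forall u, curvature c u = dot (deriveC (deriveC c) u) (normal c u).
Proof.
intros Hc u; unfold curvature, arc_derive at 1; rewrite Hc.
replace (deriveC (tangent c) u) with (deriveC (deriveC c) u).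
- f_equal; field.
- unfold deriveC at 1 3; f_equal; apply Derive_ext; intros v;
    now rewrite (tangent_unit_speed c Hc).
Qed.

Definition solution (A B : R) (X : R -> C) : Prop :=
  smooth X /\ unit_speed X /\
  forall s, A * dot (X s) (tangent X s) + B * dot (X s) (normal X s)
            = curvature X s.

(* [compact] of Stdlib is for sets of reals only. *)
Definition compactC (K : C -> Prop) : Prop :=
  forall F : (C -> Prop) -> Prop,
    (forall U, F U -> open U) ->
    (forall z, K z -> exists U, F U /\ U z) ->
    exists l : list (C -> Prop),
      (forall U, In U l -> F U) /\
      (forall z, K z -> exists U, In U l /\ U z).

Definition proper (X : R -> C) : Prop :=
  forall K : C -> Prop, compactC K -> compact (fun s => K (X s)).

(* Injective immersion which is a homeomorphism onto its image. *)
Definition embedded (X : R -> C) : Prop :=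
  immersed X /\
  (forall s s', X s = X s' -> s = s') /\
  (forall s eps, 0 < eps ->
     exists delta, 0 < delta /\
       forall s', Cmod (X s' - X s)%C < delta -> Rabs (s' - s) < eps).

Definition properly_embedded (X : R -> C) : Prop := embedded X /\ proper X.

Definition closest (X : R -> C) (s0 : R) : Prop :=
  forall s, Cmod (X s0) <= Cmod (X s).

Definition min_dist (X : R -> C) (d : R) : Prop :=
  exists s0, closest X s0 /\ Cmod (X s0) = d.

(* The two halves of [X] at [X s0]; each is restricted to parameters [r >= 0]
   and traversed away from [X s0], so that [tangent Y] is the outward unit
   tangent of the arm [Y]. *)
Definition is_arm (X : R -> C) (s0 : R) (Y : R -> C) : Prop :=
  Y = (fun r => X (s0 + r)) \/ Y = (fun r => X (s0 - r)).

Definition diverges (f : R -> R) : Prop :=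
  is_lim f p_infty p_infty \/ is_lim f p_infty m_infty.

Definition distance_increases_to_infinity (Y : R -> C) : Prop :=
  (forall r1 r2, 0 <= r1 < r2 -> Cmod (Y r1) < Cmod (Y r2)) /\
  is_lim (fun r => Cmod (Y r)) p_infty p_infty.

(* [r] is the arc length, the arms considered being of unit speed. *)
Definition infinite_total_curvature (Y : R -> C) : Prop :=
  diverges (fun r => RInt (curvature Y) 0 r).

(* The polar angle is only considered for [0 < r], since the arm may start at
   the origin. *)
Definition polar_angle (Y : R -> C) (theta : R -> R) : Prop :=
  forall r, 0 < r ->
    continuous theta r /\ Y r = (Cmod (Y r) * expi (theta r))%C.

Definition spirals_infinitely (Y : R -> C) : Prop :=
  exists theta, polar_angle Y theta /\ diverges theta.

Definition growing_direction (Y : R -> C) (w : C) : Prop :=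
  filterlim (fun r => (Cmod (Y r) * tangent Y r / Y r)%C)
            (Rbar_locally p_infty) (locally w).

Definition diffeo (phi : R -> R) : Prop :=
  smooth_fun phi /\
  exists psi, smooth_fun psi /\
    (forall u, psi (phi u) = u) /\ (forall u, phi (psi u) = u).

Definition same_up_to_rotation_reparam (X Y : R -> C) : Prop :=
  exists theta phi, diffeo phi /\ forall u, Y u = (expi theta * X (phi u))%C.

(* Derivative at [t] of a function of time on [[0, +oo)]: one-sided at [0]. *)
Definition is_time_derive (f : R -> C) (t : R) (v : C) : Prop :=
  filterdiff (K := R_AbsRing) (U := R_NormedModule) (V := C_R_NormedModule)
    f (within (fun s => 0 <= s) (locally t)) (fun h => scal h v).

(* Only the normal component of the velocity is prescribed, which is the flow
   up to tangential diffeomorphisms. *)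
Definition curve_shortening_flow (X : R -> C) (Xh : R -> R -> C) : Prop :=
  (forall u, Xh u 0 = X u) /\
  forall t, 0 <= t ->
    immersed (fun u => Xh u t) /\
    forall u, exists v,
      is_time_derive (Xh u) t v /\
      dot v (normal (fun w => Xh w t) u) = curvature (fun w => Xh w t) u.

(* Main.v *)
Require Import Defs.
From Stdlib Require Import Reals Lra Lia Ranalysis5 List.
From Stdlib Require Import ClassicalEpsilon FunctionalExtensionality.
From Coquelicot Require Import Coquelicot.
Open Scope R_scope.

(** Write t = <X,T> and n = <X,N>. The equation k = A t + B n turns the Frenet
    equations into the autonomous system t' = 1 + k n, n' = - k t. With p = k / A
    and M = B t - A n it reads p' = 1 - p M, M' = B + A^2 p^2, so M is
    nondecreasing; it cannot stay bounded, and then p tends to 0 while p M is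
    eventually at least 1/2. The asymptotics of an arm follow from this, since
    |X|^2 (A^2 + B^2) = A^2 p^2 + M^2, the total curvature dominates ln M and the
    polar angle stays at bounded distance from the tangent angle. The system is
    invariant under (t, n)(s) -> -(t, n)(-s), which deals with the other end.
    At a zero of t one has t' = 1 + B n^2 > 0, so the closest point exists and is
    unique.

    For embeddedness, parametrize both arms by x = |X|^2 and let alpha be the
    angle from the position to the outward tangent. By uniqueness for the system
    the two values of tan alpha never agree, unless the curve passes through the
    origin and is centrally symmetric. Since B >= 0, comparing the equations of
    the arms confines the difference of their polar angles to (0, PI). Existence is
    Picard iteration on the tangent angle alone: X is a primitive of a unit
    vector, hence bounded a priori on compact intervals. *)

(** * Calculus *)

(** With X and T complex, X conj(T) = t + i n, so (B + iA) X conj(T) = M + i k: this is the origin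
    of [p] and [M]. Once M is large and k small, X / T is close to M / (B + iA), which is the
    limiting growing direction. The same factor governs the flow: a family lambda(t) X solves it as
    soon as lambda' conj(lambda) = B + iA.

    The obstacle to embeddedness is that both arms wind infinitely often, so a crossing cannot be
    excluded by looking at angles modulo 2 PI; a continuous determination has to be followed from
    the closest point. Each arm alone is injective because the distance increases. The parameter
    |X|^2 is chosen because the rates of the angles then depend only on V = tan alpha and on the
    parameter, and the polar angle has the simple rate V / (2 x). The pair (x, V) also determines
    (t, n), because t > 0 on an arm; that is what lets uniqueness for the system separate the values
    of V.

    For existence, the system for (t, n) has a quadratic right side, for which a Lipschitz argument
    yields local solutions only; in terms of the tangent angle the Lipschitz constant is finite on
    every interval. *)

Lemma mvt (f f' : R -> R) (a b : R) :
  a < b -> (forall c, a <= c <= b -> is_derive f c (f' c)) ->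
  exists c, f b - f a = f' c * (b - a) /\ a < c < b.
Proof.
intros Hab Hf; apply MVT_cor2; trivial.
intros c Hc; now apply is_derive_Reals, Hf.
Qed.

Lemma derive_le_lower (f f' : R -> R) (m a b : R) :
  a <= b -> (forall c, a <= c <= b -> is_derive f c (f' c)) ->
  (forall c, a < c < b -> m <= f' c) -> m * (b - a) <= f b - f a.
Proof.
intros [Hab | ->] Hf Hm; [|lra].
destruct (mvt f f' a b Hab Hf) as [c [-> Hc]].
apply Rmult_le_compat_r; [lra | now apply Hm].
Qed.

Lemma derive_pos_lt (f f' : R -> R) (a b : R) :
  a < b -> (forall c, a <= c <= b -> is_derive f c (f' c)) ->
  (forall c, a < c < b -> 0 < f' c) -> f a < f b.
Proof.
intros Hab Hf Hm.
destruct (mvt f f' a b Hab Hf) as [c [Hc Hc']].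
specialize (Hm c Hc').
assert (0 < f' c * (b - a)) by (apply Rmult_lt_0_compat; lra); lra.
Qed.

Lemma derive_zero_const (f : R -> R) :
  (forall s, is_derive f s 0) -> forall a b, f a = f b.
Proof.
intros Hf.
assert (H : forall a b, a <= b -> f a = f b).
{ intros a b [Hab | ->]; trivial.
  destruct (mvt f (fun _ => 0) a b Hab (fun c _ => Hf c)) as [c [Hc _]]; lra. }
intros a b; destruct (Rle_dec a b) as [h | h]; [now apply H|].
symmetry; apply H; lra.
Qed.

Lemma is_derive_continuous (f : R -> R) (x l : R) :
  is_derive f x l -> continuous f x.
Proof. intros Hf; apply (@ex_derive_continuous R_AbsRing R_NormedModule); now exists l. Qed.

Lemma is_derive_continuity_pt (f : R -> R) (x l : R) :
  is_derive f x l -> continuity_pt f x.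
Proof. intros Hf; apply continuity_pt_filterlim; now apply (is_derive_continuous f x l). Qed.

Lemma is_derive_primitive (f : R -> R) :
  (forall s, continuous f s) -> forall s, is_derive (RInt f 0) s (f s).
Proof.
intros Hf s; apply (is_derive_RInt f (RInt f 0) 0); trivial.
apply filter_forall; intros b.
apply (RInt_correct (V := R_CompleteNormedModule)).
apply (ex_RInt_continuous f); intros; apply Hf.
Qed.

Lemma continuous_primitive (f : R -> R) (c : R) :
  (forall s, continuous f s) ->
  exists F, F 0 = c /\ forall s, is_derive F s (f s).
Proof.
intros Hf; exists (fun s => c + RInt f 0 s); split.
- rewrite RInt_point; apply Rplus_0_r.
- intros s; replace (f s) with (0 + f s) by ring.
  apply (is_derive_plus (fun _ => c) (RInt f 0)).
  + apply (is_derive_const c).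
  + now apply is_derive_primitive.
Qed.

Ltac derive_tac :=
  unfold Rminus in *; auto_derive;
  [ repeat split; trivial; try (eexists; eassumption)
  | repeat match goal with
    | H : is_derive ?f ?s ?l |- _ =>
        progress (change (Derive (fun x => f x)) with (Derive f);
                  rewrite !(is_derive_unique _ _ _ H))
    end ].

Lemma eventually_infty (P : R -> Prop) (K : R) :
  (forall s, K <= s -> P s) -> Rbar_locally p_infty P.
Proof. intros H; exists K; intros s Hs; apply H; lra. Qed.

(* The positive part of [f - e], squared, is nonincreasing. *)
Lemma barrier (f f' : R -> R) (e a b : R) :
  a <= b -> (forall s, a <= s <= b -> is_derive f s (f' s)) ->
  (forall s, a <= s <= b -> e <= f s -> f' s <= 0) ->
  f a <= e -> f b <= e.
Proof.
intros Hab Hf Hneg Ha.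
set (h := fun x => (Rmax (x - e) 0) ^ 2).
(* The first-order error is at most [d * d] everywhere, also at the corner [x = e]. *)
assert (Hh : forall x, is_derive h x (2 * Rmax (x - e) 0)).
{ intros x; apply is_derive_Reals; intros eps Heps.
  exists (mkposreal eps Heps); intros d Hd Hde; simpl in Hde.
  unfold h.
  assert (H : Rabs (Rmax (x + d - e) 0 ^ 2 - Rmax (x - e) 0 ^ 2
                 - 2 * Rmax (x - e) 0 * d) <= d * d).
  { unfold Rmax; destruct (Rle_dec (x + d - e) 0), (Rle_dec (x - e) 0);
      apply Rabs_le; split; nra. }
  replace ((Rmax (x + d - e) 0 ^ 2 - Rmax (x - e) 0 ^ 2) / d
           - 2 * Rmax (x - e) 0)
    with ((Rmax (x + d - e) 0 ^ 2 - Rmax (x - e) 0 ^ 2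
           - 2 * Rmax (x - e) 0 * d) / d) by now field.
  unfold Rdiv; rewrite Rabs_mult, Rabs_inv.
  assert (Hp : 0 < Rabs d) by now apply Rabs_pos_lt.
  apply Rle_lt_trans with (d * d * / Rabs d).
  - apply Rmult_le_compat_r; trivial.
    now apply Rlt_le, Rinv_0_lt_compat.
  - replace (d * d) with (Rabs d * Rabs d).
    + now replace (Rabs d * Rabs d * / Rabs d) with (Rabs d) by (field; lra).
    + rewrite <- Rabs_mult; apply Rabs_pos_eq; nra. }
assert (Hle : 0 * (b - a) <= - h (f b) - - h (f a)).
{ apply (derive_le_lower (fun s => - h (f s))
    (fun s => - (f' s * (2 * Rmax (f s - e) 0)))); trivial.
  - intros c Hc; apply (is_derive_opp (fun s => h (f s))).
    apply (is_derive_comp h f); auto.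
  - intros c Hc; unfold Rmax; destruct (Rle_dec (f c - e) 0); [lra|].
    assert (f' c <= 0) by (apply Hneg; lra); nra. }
revert Hle; unfold h, Rmax.
destruct (Rle_dec (f b - e) 0), (Rle_dec (f a - e) 0); try lra; nra.
Qed.

(** As long as [f] stays above [e] it falls at rate at least [c], so it meets [e] after a time of
    about [|f a - e| / c]; from then on [barrier] keeps it below. *)
Lemma eventually_le_of_drift (f f' : R -> R) (e c : R) :
  0 < c -> (forall s, is_derive f s (f' s)) ->
  Rbar_locally p_infty (fun s => e <= f s -> f' s <= - c) ->
  Rbar_locally p_infty (fun s => f s <= e).
Proof.
intros Hc Hf [S HS].
assert (Hx : exists s, S < s /\ f s <= e).
{ set (a := S + 1); set (b := a + Rabs (f a - e) / c + 1).
  assert (Hq : 0 <= Rabs (f a - e) / c).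
  { apply Rdiv_le_0_compat; trivial; apply Rabs_pos. }
  destruct (Rle_dec (f b) e) as [h | h].
  { exists b; split; trivial; unfold b, a in *; lra. }
  assert (Hall : exists s, a <= s <= b /\ f s <= e).
  { apply Classical_Prop.NNPP; intros Hn.
    assert (Hgt : forall s, a <= s <= b -> e < f s).
    { intros s Hs; destruct (Rlt_dec e (f s)); trivial.
      exfalso; apply Hn; exists s; split; trivial; lra. }
    assert (c * (b - a) <= - f b - - f a).
    { apply (derive_le_lower (fun s => - f s) (fun s => - f' s)).
      - unfold b; lra.
      - intros s _; apply (is_derive_opp f), Hf.
      - intros s Hs. assert (f' s <= - c); [|lra].
        apply HS; [unfold a in Hs; lra|]. apply Rlt_le, Hgt; lra. }
    assert (Hb : c * (b - a) = Rabs (f a - e) + c).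
    { unfold b; field; lra. }
    pose proof (Rle_abs (f a - e)).
    lra. }
  destruct Hall as [s [Hs Hs']]; exists s; split; trivial.
  unfold a in Hs; lra. }
destruct Hx as [s0 [Hs0 Hfs0]].
apply (eventually_infty _ s0); intros s Hs.
apply (barrier f f' e s0 s); trivial.
intros r Hr Her; assert (f' r <= - c) by (apply HS; trivial; lra); lra.
Qed.

(** * The system for the tangential and normal components of the position *)

Definition support_system (A B : R) (t n : R -> R) : Prop :=
  forall s, is_derive t s (1 + (A * t s + B * n s) * n s) /\
            is_derive n s (- ((A * t s + B * n s) * t s)).

Lemma is_derive_reverse (f : R -> R) (a s l : R) :
  is_derive f (a - s) l -> is_derive (fun r => f (a - r)) s (- l).
Proof. intros H; derive_tac; ring. Qed.

Lemma is_derive_shift (f : R -> R) (a s l : R) :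
  is_derive f (a + s) l -> is_derive (fun r => f (a + r)) s l.
Proof. intros H; derive_tac; ring. Qed.

Lemma system_reverse (A B a : R) (t n : R -> R) :
  support_system A B t n ->
  support_system A B (fun s => - t (a - s)) (fun s => - n (a - s)).
Proof.
intros H s; destruct (H (a - s)) as [Ht Hn]; split; derive_tac; ring.
Qed.

Lemma system_shift (A B a : R) (t n : R -> R) :
  support_system A B t n ->
  support_system A B (fun s => t (a + s)) (fun s => n (a + s)).
Proof.
intros H s; destruct (H (a + s)) as [Ht Hn]; split; derive_tac; ring.
Qed.

Lemma system_derive_dist (A B : R) (t n : R -> R) :
  support_system A B t n ->
  forall s, is_derive (fun r => t r ^ 2 + n r ^ 2) s (2 * t s).
Proof.
intros H s; destruct (H s) as [Ht Hn]; derive_tac; ring.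
Qed.

Lemma continuous_bounded (f : R -> R) (a b : R) :
  a <= b -> (forall s, continuous f s) ->
  exists M, forall s, a <= s <= b -> Rabs (f s) <= M.
Proof.
intros Hab Hf.
destruct (continuity_ab_maj (fun s => Rabs (f s)) a b Hab) as [c [Hc _]].
- intros s _; apply continuity_pt_filterlim.
  apply (continuous_comp f Rabs); [apply Hf | apply continuous_Rabs].
- now exists (Rabs (f c)).
Qed.

(* Gronwall applied to [(t1 - t2)^2 + (n1 - n2)^2]. *)
Lemma system_unique_forward (A B : R) (t1 n1 t2 n2 : R -> R) (a : R) :
  support_system A B t1 n1 -> support_system A B t2 n2 ->
  t1 a = t2 a -> n1 a = n2 a ->
  forall s, a <= s -> t1 s = t2 s /\ n1 s = n2 s.
Proof.
intros H1 H2 Hta Hna b Hb.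
destruct (continuous_bounded t1 a b Hb) as [Mt HMt].
{ intros s; now destruct (H1 s) as [h _]; apply is_derive_continuous in h. }
destruct (continuous_bounded n1 a b Hb) as [Mn HMn].
{ intros s; now destruct (H1 s) as [_ h]; apply is_derive_continuous in h. }
set (u := fun s => t1 s - t2 s); set (v := fun s => n1 s - n2 s).
set (L := 2 * (Rabs A + Rabs B) * (Mt + Mn)).
set (g := fun s => - (exp (- (2 * L) * s) * (u s ^ 2 + v s ^ 2))).
(* [D] is the derivative of [u ^ 2 + v ^ 2]. The part of the difference that carries the curvature
   of the second solution rotates (u, v) and cancels, so bounds on the first solution suffice. *)
set (D := fun s => 2 * (A * u s + B * v s) * (u s * n1 s - v s * t1 s)).
assert (Hg : forall s, is_derive g s
   (exp (- (2 * L) * s) * (2 * L * (u s ^ 2 + v s ^ 2) - D s))).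
{ intros s; destruct (H1 s) as [Ht1 Hn1], (H2 s) as [Ht2 Hn2].
  unfold g, D, u, v; derive_tac; ring. }
assert (HD : forall s, a <= s <= b -> D s <= 2 * L * (u s ^ 2 + v s ^ 2)).
{ intros s Hs; specialize (HMt s Hs); specialize (HMn s Hs).
  unfold D; clearbody u v; clear - HMt HMn.
  assert (h1 : Rabs (A * u s + B * v s)
               <= (Rabs A + Rabs B) * (Rabs (u s) + Rabs (v s))).
  { eapply Rle_trans; [apply Rabs_triang|]; rewrite !Rabs_mult.
    pose proof (Rabs_pos A); pose proof (Rabs_pos B).
    pose proof (Rabs_pos (u s)); pose proof (Rabs_pos (v s)); nra. }
  assert (h2 : Rabs (u s * n1 s - v s * t1 s)
               <= (Mt + Mn) * (Rabs (u s) + Rabs (v s))).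
  { unfold Rminus; eapply Rle_trans; [apply Rabs_triang|].
    rewrite Rabs_Ropp, !Rabs_mult.
    pose proof (Rabs_pos (t1 s)); pose proof (Rabs_pos (n1 s)).
    pose proof (Rabs_pos (u s)); pose proof (Rabs_pos (v s)); nra. }
  assert (h3 : Rabs (2 * (A * u s + B * v s) * (u s * n1 s - v s * t1 s))
               <= L * (Rabs (u s) + Rabs (v s)) ^ 2).
  { rewrite !Rabs_mult, (Rabs_pos_eq 2) by lra; unfold L.
    pose proof (Rmult_le_compat _ _ _ _ (Rabs_pos _) (Rabs_pos _) h1 h2); lra. }
  assert (HL : 0 <= L).
  { unfold L; pose proof (Rabs_pos A); pose proof (Rabs_pos B).
    pose proof (Rabs_pos (t1 s)); pose proof (Rabs_pos (n1 s)).
    apply Rmult_le_pos; lra. }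
  eapply Rle_trans; [apply Rle_abs|]; eapply Rle_trans; [apply h3|].
  rewrite (Rmult_comm 2 L), Rmult_assoc; apply Rmult_le_compat_l; trivial.
  rewrite <- (pow2_abs (u s)), <- (pow2_abs (v s)).
  pose proof (pow2_ge_0 (Rabs (u s) - Rabs (v s))); lra. }
assert (Hle : 0 * (b - a) <= g b - g a).
{ eapply derive_le_lower; [exact Hb | intros s _; apply Hg |].
  intros s Hs; apply Rmult_le_pos; [apply Rlt_le, exp_pos|].
  assert (D s <= 2 * L * (u s ^ 2 + v s ^ 2)) by (apply HD; lra); lra. }
assert (Ha : g a = 0) by (unfold g, u, v; rewrite Hta, Hna; ring).
assert (Hz : u b ^ 2 + v b ^ 2 <= 0).
{ rewrite Ha in Hle; unfold g in Hle.
  pose proof (exp_pos (- (2 * L) * b)); nra. }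
split; apply Rminus_diag_uniq; [change (u b = 0) | change (v b = 0)];
  generalize dependent (u b); generalize dependent (v b); intros; nra.
Qed.

Lemma system_unique (A B : R) (t1 n1 t2 n2 : R -> R) (a : R) :
  support_system A B t1 n1 -> support_system A B t2 n2 ->
  t1 a = t2 a -> n1 a = n2 a -> forall s, t1 s = t2 s /\ n1 s = n2 s.
Proof.
intros H1 H2 Ht Hn s; destruct (Rle_dec a s) as [h | h].
- now apply (system_unique_forward A B t1 n1 t2 n2 a).
- destruct (system_unique_forward A B _ _ _ _ (- a)
    (system_reverse A B 0 t1 n1 H1) (system_reverse A B 0 t2 n2 H2)) with (- s)
    as [Ht' Hn']; try lra.
  + now replace (0 - - a) with a by ring; rewrite Ht.
  + now replace (0 - - a) with a by ring; rewrite Hn.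
  + cbv beta in Ht', Hn'; replace (0 - - s) with s in Ht', Hn' by ring; lra.
Qed.

(** The equation reads t' - A n t = 1 + B n^2 > 0. With N a primitive of A n, the integrating factor
    exp(-N) makes t exp(-N) strictly increasing. *)
Lemma system_tangential_pos (A B : R) (t n : R -> R) (a : R) :
  0 <= B -> support_system A B t n -> t a = 0 -> forall s, a < s -> 0 < t s.
Proof.
intros HB H Ha b Hb.
destruct (continuous_primitive (fun s => A * n s) 0) as [N [_ HN]].
{ intros s; destruct (H s) as [_ h].
  apply is_derive_continuous with (A * - ((A * t s + B * n s) * t s)).
  derive_tac; ring. }
assert (Hlt : t a * exp (- N a) < t b * exp (- N b)).
{ apply (derive_pos_lt (fun s => t s * exp (- N s))
    (fun s => (1 + B * n s ^ 2) * exp (- N s))); trivial.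
  - intros s _; destruct (H s) as [h _]; specialize (HN s).
    derive_tac; ring.
  - intros s _; apply Rmult_lt_0_compat; [|apply exp_pos].
    pose proof (pow2_ge_0 (n s)); nra. }
rewrite Ha in Hlt; pose proof (exp_pos (- N b)).
destruct (Rlt_dec 0 (t b)); trivial; nra.
Qed.

Lemma system_tangential_neg (A B : R) (t n : R -> R) (a : R) :
  0 <= B -> support_system A B t n -> t a = 0 -> forall s, s < a -> t s < 0.
Proof.
intros HB H Ha s Hs.
assert (Hp : 0 < - t (0 - - s)).
{ apply (system_tangential_pos A B _ _ (- a) HB (system_reverse A B 0 t n H));
    [|lra].
  replace (0 - - a) with a by ring; lra. }
replace (0 - - s) with s in Hp by ring; lra.
Qed.

(** * Behaviour of the system as the parameter tends to infinity *)

Section Asymptotics.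

Variables (A B : R) (t n : R -> R).
Hypotheses (HA : A <> 0) (HB : 0 <= B) (H : support_system A B t n).

Let p (s : R) : R := t s + B / A * n s.
Let M (s : R) : R := B * t s - A * n s.

Lemma derive_p (s : R) : is_derive p s (1 - p s * M s).
Proof.
destruct (H s) as [Ht Hn]; unfold p, M; derive_tac; field; trivial.
Qed.

Lemma derive_M (s : R) : is_derive M s (B + A ^ 2 * p s ^ 2).
Proof.
destruct (H s) as [Ht Hn]; unfold p, M; derive_tac; field; trivial.
Qed.

Lemma M_incr (a b : R) : a <= b -> M a <= M b.
Proof.
intros Hab.
assert (0 * (b - a) <= M b - M a); [|lra].
apply derive_le_lower with (fun s => B + A ^ 2 * p s ^ 2); trivial.
- intros s _; apply derive_M.
- intros s _; pose proof (pow2_ge_0 (A * p s)); nra.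
Qed.

(* If [|M| <= K] on [[0, +oo)], then for c = A^2 / K^2 the derivative of
   [M + c atan p] is at least c / 2 there. *)
Lemma M_unbounded (K : R) : exists s, 0 <= s /\ K < M s.
Proof.
apply Classical_Prop.NNPP; intros Hn.
assert (HK : forall s, 0 <= s -> M s <= K).
{ intros s Hs; destruct (Rle_dec (M s) K); trivial.
  exfalso; apply Hn; exists s; lra. }
(* A bound for |M| on the half-line, since M lies between [M 0] and [K]. The 1 gives [c <= A ^ 2],
   which absorbs a term c x^2 / 2 at the end of the estimate. *)
set (K1 := Rmax 1 (Rmax K (- M 0))).
assert (HK1 : 1 <= K1) by apply Rmax_l.
assert (HM : forall s, 0 <= s -> - K1 <= M s <= K1).
{ intros s Hs; specialize (HK s Hs); pose proof (M_incr 0 s Hs).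
  pose proof (Rmax_r 1 (Rmax K (- M 0))); fold K1 in H1.
  pose proof (Rmax_l K (- M 0)); pose proof (Rmax_r K (- M 0)); lra. }
set (c := A ^ 2 / K1 ^ 2).
assert (Hc1 : c * K1 ^ 2 = A ^ 2) by (unfold c; field; lra).
assert (HA2 : 0 < A ^ 2) by now apply pow2_gt_0.
assert (Hc0 : 0 < c) by (apply Rdiv_lt_0_compat; trivial; apply pow_lt; lra).
assert (HcA : c <= A ^ 2).
{ rewrite <- Hc1; assert (1 <= K1 ^ 2) by (apply pow_R1_Rle; lra); nra. }
set (g := fun s => M s + c * atan (p s)).
assert (Hg : forall b, 0 <= b -> c / 2 * (b - 0) <= g b - g 0).
{ intros b Hb.
  apply derive_le_lower with
    (fun s => B + A ^ 2 * p s ^ 2 + c * ((1 - p s * M s) / (1 + p s ^ 2)));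
    trivial.
  - intros s _; apply (is_derive_plus M (fun r => c * atan (p r)));
      [apply derive_M|].
    apply (is_derive_scal (fun r => atan (p r))).
    pose proof (derive_p s) as Hp; derive_tac.
    change (p s * (p s * 1)) with (p s ^ 2); unfold Rsqr.
    field; pose proof (pow2_ge_0 (p s)); simpl in *; lra.
  - intros s Hs; destruct (HM s) as [Hl Hu]; [lra|].
    generalize (p s) (M s) Hl Hu; intros x y Hl' Hu'.
    assert (Hx : 0 < 1 + x ^ 2) by (pose proof (pow2_ge_0 x); lra).
    assert (Hxy : x * y <= K1 * Rabs x).
    { eapply Rle_trans; [apply Rle_abs|]; rewrite Rabs_mult.
      rewrite (Rmult_comm K1); apply Rmult_le_compat_l; [apply Rabs_pos|].
      now apply Rabs_le. }
    (* The inequality 2 z <= z^2 + 1 for z = K1 |x|, multiplied by c / 2, where c K1^2 = A^2. *)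
    assert (Hsq : c * (K1 * Rabs x) <= A ^ 2 * x ^ 2 / 2 + c / 2).
    { rewrite <- Hc1, <- (pow2_abs x).
      assert (h : 0 <= c * (K1 * Rabs x - 1) ^ 2)
        by (apply Rmult_le_pos; [lra | apply pow2_ge_0]).
      replace (c * K1 ^ 2 * Rabs x ^ 2 / 2 + c / 2)
        with (c * (K1 * Rabs x) + c * (K1 * Rabs x - 1) ^ 2 / 2) by field.
      lra. }
    replace (B + A ^ 2 * x ^ 2 + c * ((1 - x * y) / (1 + x ^ 2)))
      with (c / 2 + ((B + A ^ 2 * x ^ 2 - c / 2) * (1 + x ^ 2)
                     + c * (1 - x * y)) / (1 + x ^ 2)) by (field; lra).
    assert (0 <= ((B + A ^ 2 * x ^ 2 - c / 2) * (1 + x ^ 2)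
                  + c * (1 - x * y)) / (1 + x ^ 2)); [|lra].
    apply Rdiv_le_0_compat; trivial.
    pose proof (pow2_ge_0 x) as Hx2.
    assert (h1 : c * (x * y) <= c * (K1 * Rabs x))
      by (apply Rmult_le_compat_l; lra).
    assert (h2 : 0 <= B * (1 + x ^ 2)) by (apply Rmult_le_pos; lra).
    assert (h3 : 0 <= A ^ 2 * x ^ 2 * x ^ 2)
      by (apply Rmult_le_pos; [apply Rmult_le_pos|]; lra).
    assert (h4 : c * x ^ 2 <= A ^ 2 * x ^ 2)
      by (apply Rmult_le_compat_r; lra).
    nra. }
(* The arctangent is below 2, so [g] never exceeds [K1 + 2 * c]; at time [b] growth at rate [c / 2]
   would carry it to [K1 + 2 * c + 1]. *)
set (b := 2 / c * (K1 - g 0 + 2 * c + 1)).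
assert (Hat : forall x, - 2 < atan x < 2).
{ intros x; pose proof (atan_bound x); pose proof PI_4; lra. }
assert (Hb : 0 <= b).
{ unfold b; apply Rmult_le_pos; [apply Rlt_le, Rdiv_lt_0_compat; lra|].
  unfold g; destruct (HM 0) as [_ h]; [lra|].
  pose proof (Hat (p 0)); nra. }
specialize (Hg b Hb).
assert (Hcb : c / 2 * (b - 0) = K1 - g 0 + 2 * c + 1)
  by (unfold b; field; lra).
destruct (HM b Hb) as [_ h]; unfold g at 1 in Hg.
pose proof (Hat (p b)); nra.
Qed.

Lemma M_eventually (K : R) : Rbar_locally p_infty (fun s => K < M s).
Proof.
destruct (M_unbounded K) as [s0 [_ Hs0]].
apply (eventually_infty _ s0); intros s Hs; pose proof (M_incr s0 s Hs); lra.
Qed.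

(** Since p' = 1 - p M, once M > 2 / e the inequality p >= e forces p' <= -1, and once M > 0 the
    inequality p <= -e forces p' >= 1. Both are drifts towards the strip. *)
Lemma p_eventually (e : R) :
  0 < e -> Rbar_locally p_infty (fun s => - e <= p s <= e).
Proof.
intros He.
assert (H1 : Rbar_locally p_infty (fun s => p s <= e)).
{ apply (eventually_le_of_drift p (fun s => 1 - p s * M s) e 1);
    [lra | apply derive_p |].
  generalize (M_eventually (2 / e)); apply filter_imp; intros s Hs Hp.
  assert (e * (2 / e) = 2) by (field; lra).
  assert (0 < 2 / e) by (apply Rdiv_lt_0_compat; lra).
  assert (e * (2 / e) <= p s * M s) by (apply Rmult_le_compat; lra); lra. }
assert (H2 : Rbar_locally p_infty (fun s => - p s <= e)).
{ apply (eventually_le_of_drift (fun s => - p s) (fun s => - (1 - p s * M s))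
    e 1);
    [lra | intros s; apply (is_derive_opp p), derive_p |].
  generalize (M_eventually 0); apply filter_imp; intros s Hs Hp.
  assert (0 <= - p s * M s) by (apply Rmult_le_pos; lra); lra. }
generalize (filter_and _ _ H1 H2); apply filter_imp; intros s Hs; lra.
Qed.

(** The derivative of p M is (1 - p M) M + p (B + A^2 p^2). While p M <= 1/2 the first term is at
    least M / 2, and for |p| <= 1 the second is at least -(B + A^2); so M > 2 (1 + B + A^2) produces
    an upward drift of at least 1. The bound says that p decays no faster than 1 / (2 M), which
    keeps its integral infinite. *)
Lemma pM_eventually : Rbar_locally p_infty (fun s => / 2 <= p s * M s).
Proof.
assert (H1 : Rbar_locally p_infty (fun s => - (p s * M s) <= - / 2)).
{ apply (eventually_le_of_drift (fun s => - (p s * M s))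
   (fun s => - ((1 - p s * M s) * M s + p s * (B + A ^ 2 * p s ^ 2)))
   (- / 2) 1); [lra | |].
  - intros s; pose proof (derive_p s); pose proof (derive_M s).
    derive_tac; ring.
  - pose proof (p_eventually 1 Rlt_0_1) as Hp.
    pose proof (M_eventually (2 * (1 + B + A ^ 2))) as HM.
    generalize (filter_and _ _ Hp HM); apply filter_imp.
    intros s [Hps HMs] Hs.
    pose proof (pow2_ge_0 A) as HA2.
    assert (Hp2 : p s ^ 2 <= 1) by nra.
    pose proof (pow2_ge_0 (p s)).
    assert (HA3 : A ^ 2 * p s ^ 2 <= A ^ 2) by nra.
    assert (HA4 : 0 <= A ^ 2 * p s ^ 2) by nra.
    assert (/ 2 * M s <= (1 - p s * M s) * M s)
      by (apply Rmult_le_compat_r; lra).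
    assert (- (B + A ^ 2) <= p s * (B + A ^ 2 * p s ^ 2)) by nra.
    lra. }
revert H1; apply filter_imp; intros s Hs; lra.
Qed.

Lemma tangential_of_p_M (s : R) :
  t s = (A ^ 2 * p s + B * M s) / (A ^ 2 + B ^ 2).
Proof. unfold p, M; field; split; trivial; nra. Qed.

Lemma normal_of_p_M (s : R) :
  n s = A * (B * p s - M s) / (A ^ 2 + B ^ 2).
Proof. unfold p, M; field; split; trivial; nra. Qed.

(** Up to a positive factor t is A^2 p + B M. For B = 0 only p is left, so its sign must be known
    too; it follows from M > 0 and p M >= 1/2. *)
Lemma tangential_eventually_pos : Rbar_locally p_infty (fun s => 0 < t s).
Proof.
generalize (filter_and _ _ (M_eventually 0) pM_eventually); apply filter_imp.
intros s [HM Hp]; rewrite tangential_of_p_M.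
assert (Hps : 0 < p s).
{ destruct (Rlt_dec 0 (p s)); trivial; nra. }
pose proof (pow2_gt_0 A HA); pose proof (pow2_ge_0 B).
apply Rdiv_lt_0_compat; nra.
Qed.

Lemma dist_eventually (K : R) :
  Rbar_locally p_infty (fun s => K < t s ^ 2 + n s ^ 2).
Proof.
set (D := A ^ 2 + B ^ 2).
assert (HD : 0 < D) by (unfold D; pose proof (pow2_gt_0 A HA); nra).
generalize (M_eventually (Rabs K * D + 1)); apply filter_imp; intros s Hs.
assert (HK : K * D <= Rabs K * D)
  by (apply Rmult_le_compat_r; [lra | apply Rle_abs]).
assert (HK0 : 0 <= Rabs K * D)
  by (apply Rmult_le_pos; [apply Rabs_pos | lra]).
assert (Hd : (t s ^ 2 + n s ^ 2) * D = A ^ 2 * p s ^ 2 + M s ^ 2)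
  by (unfold D, p, M; field; trivial).
assert (0 <= A ^ 2 * p s ^ 2) by (apply Rmult_le_pos; apply pow2_ge_0).
assert (K * D < (t s ^ 2 + n s ^ 2) * D) by nra.
apply Rmult_lt_reg_r with D; trivial.
Qed.

Lemma curvature_eventually (e : R) :
  0 < e -> Rbar_locally p_infty (fun s => Rabs (A * t s + B * n s) < e).
Proof.
intros He.
assert (He' : 0 < e / (2 * Rabs A))
  by (pose proof (Rabs_pos_lt A HA); apply Rdiv_lt_0_compat; lra).
generalize (p_eventually _ He'); apply filter_imp; intros s Hs.
replace (A * t s + B * n s) with (A * p s) by (unfold p; field; trivial).
rewrite Rabs_mult; apply Rabs_le in Hs.
assert (HA' := Rabs_pos_lt A HA).
apply Rmult_le_compat_l with (r := Rabs A) in Hs; [|lra].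
replace (Rabs A * (e / (2 * Rabs A))) with (e / 2) in Hs by (field; lra).
lra.
Qed.

(* Eventually (ln M)' = (B + A^2 p^2) / M <= 2 (B + A^2) p. *)
Lemma total_curvature_eventually (phi : R -> R) (K : R) :
  (forall s, is_derive phi s (A * t s + B * n s)) ->
  Rbar_locally p_infty (fun s => K < phi s / A).
Proof.
intros Hphi.
set (c := 2 * (B + A ^ 2)).
assert (Hc : 0 < c) by (unfold c; pose proof (pow2_gt_0 A HA); lra).
pose proof (filter_and _ _ (p_eventually 1 Rlt_0_1)
  (filter_and _ _ (M_eventually 1) pM_eventually)) as [S HS].
set (a := S + 1).
(* [phi / A] has derivative p, so integrating gives c (phi b - phi a) / A >= ln (M b) - ln (M a).
   The threshold [K1] is the value of M at which this bound reaches [K]. *)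
set (K1 := exp (c * (K - phi a / A) + ln (M a))).
assert (Ha : forall b, a <= b -> M b > K1 -> K < phi b / A).
{ intros b Hb HM.
  assert (Hle : 0 * (b - a)
     <= (c * (phi b / A) - ln (M b)) - (c * (phi a / A) - ln (M a))).
  { apply (derive_le_lower (fun s => c * (phi s / A) - ln (M s))
      (fun s => c * p s - (B + A ^ 2 * p s ^ 2) / M s)); trivial.
    - intros s Hs; specialize (Hphi s); pose proof (derive_M s) as HMs.
      destruct (HS s) as [_ [HM1 _]]; [unfold a in Hs; lra|].
      derive_tac; [lra|].
      unfold p; field; split; trivial; lra.
    - intros s Hs.
      destruct (HS s) as [Hp [HM1 HpM]]; [unfold a in Hs; lra|].
      replace (c * p s - (B + A ^ 2 * p s ^ 2) / M s)
        with ((c * (p s * M s) - (B + A ^ 2 * p s ^ 2)) / M s) by (field; lra).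
      apply Rdiv_le_0_compat; [|lra].
      assert (p s ^ 2 <= 1) by nra.
      pose proof (pow2_ge_0 A).
      assert (A ^ 2 * p s ^ 2 <= A ^ 2) by nra.
      assert (c * / 2 <= c * (p s * M s)) by (apply Rmult_le_compat_l; lra).
      unfold c in *; lra. }
  assert (HK : c * (K - phi a / A) + ln (M a) < ln (M b)).
  { rewrite <- (ln_exp (c * (K - phi a / A) + ln (M a))).
    apply ln_increasing; [apply exp_pos | exact HM]. }
  apply Rmult_lt_reg_l with c; lra. }
generalize (filter_and _ _ (M_eventually K1) (ex_intro _ a (fun s h => h) :
  Rbar_locally p_infty (fun s => a < s))).
apply filter_imp; intros s [h1 h2]; apply Ha; lra.
Qed.

(** The two quotients are the real and imaginary parts of |X| T / X = T conj(X) / |X| = (t - i n) /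
    |X|. After division by M > 0 they become continuous functions of w = p / M, which tends to 0,
    and their values at w = 0 are the limits. *)
Lemma growing_direction_limits :
  let D := A ^ 2 + B ^ 2 in
  is_lim (fun s => t s / sqrt (t s ^ 2 + n s ^ 2)) p_infty (B / sqrt D) /\
  is_lim (fun s => - n s / sqrt (t s ^ 2 + n s ^ 2)) p_infty (A / sqrt D).
Proof.
intros D.
assert (HD : 0 < D) by (unfold D; pose proof (pow2_gt_0 A HA); nra).
set (w := fun s => p s / M s).
assert (Hw : is_lim w p_infty 0).
{ apply is_lim_spec; intros eps.
  change (Rbar_locally p_infty (fun s => Rabs (w s - 0) < eps)).
  generalize (filter_and _ _ (p_eventually 1 Rlt_0_1)
     (M_eventually (/ eps))); apply filter_imp; intros s [Hp HM].
  pose proof (cond_pos eps) as He.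
  pose proof (Rinv_0_lt_compat _ He).
  rewrite Rminus_0_r; unfold w, Rdiv; rewrite Rabs_mult, Rabs_inv.
  rewrite (Rabs_pos_eq (M s)) by lra.
  apply Rabs_le in Hp.
  apply Rmult_lt_reg_r with (M s); [lra|].
  replace (Rabs (p s) * / M s * M s) with (Rabs (p s)) by (field; lra).
  assert (eps * / eps < eps * M s) by (apply Rmult_lt_compat_l; lra).
  rewrite Rinv_r in H1 by lra; lra. }
assert (Hroot : Rbar_locally p_infty (fun s => 0 < M s /\
   sqrt (t s ^ 2 + n s ^ 2) = M s * sqrt (A ^ 2 * w s ^ 2 + 1) / sqrt D)).
{ generalize (M_eventually 0); apply filter_imp; intros s Hs; split; trivial.
  assert (0 <= A ^ 2 * w s ^ 2) by (apply Rmult_le_pos; apply pow2_ge_0).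
  rewrite <- (sqrt_pow2 (M s)) at 1 by lra.
  rewrite <- sqrt_mult_alt, <- sqrt_div_alt by (trivial; apply pow2_ge_0).
  f_equal; unfold w, D, p, M in *; field; repeat split; trivial; nra. }
assert (Hcont : forall f : R -> R, continuous f 0 ->
   is_lim (fun s => f (w s)) p_infty (f 0)).
{ intros f Hf.
  now apply (is_lim_comp_continuous w f p_infty 0). }
assert (HsD := sqrt_lt_R0 D HD).
assert (Hsw : forall x, 0 < sqrt (A ^ 2 * x ^ 2 + 1)).
{ intros x; apply sqrt_lt_R0.
  assert (0 <= A ^ 2 * x ^ 2) by (apply Rmult_le_pos; apply pow2_ge_0); lra. }
assert (HsD2 : sqrt D * sqrt D = D) by (apply sqrt_sqrt; lra).
assert (Hc0 : forall a b, continuous (fun x =>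
   (a + b * x) / (sqrt D * sqrt (A ^ 2 * x ^ 2 + 1))) 0).
{ intros a b; apply (@ex_derive_continuous R_AbsRing R_NormedModule).
  auto_derive; repeat split.
  - lra.
  - apply Rgt_not_eq, Rmult_lt_0_compat; trivial.
    specialize (Hsw 0).
    now replace (A * (A * 1) * (0 * (0 * 1)) + 1)
      with (A ^ 2 * 0 ^ 2 + 1) by ring. }
assert (Hv : forall a b, (a + b * 0) / (sqrt D * sqrt (A ^ 2 * 0 ^ 2 + 1))
   = a / sqrt D).
{ intros a b; replace (A ^ 2 * 0 ^ 2 + 1) with 1 by ring.
  rewrite sqrt_1; field; lra. }
split.
- apply is_lim_ext_loc with
    (fun s => (B + A ^ 2 * w s) / (sqrt D * sqrt (A ^ 2 * w s ^ 2 + 1))).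
  + revert Hroot; apply filter_imp; intros s [HM ->].
    rewrite (tangential_of_p_M s).
    replace (A ^ 2 + B ^ 2) with (sqrt D * sqrt D).
    unfold w; specialize (Hsw (w s)); unfold w in Hsw; field.
    repeat split; lra.
  + rewrite <- (Hv B (A ^ 2)).
    apply (Hcont (fun x => (B + A ^ 2 * x) /
      (sqrt D * sqrt (A ^ 2 * x ^ 2 + 1)))), Hc0.
- apply is_lim_ext_loc with
    (fun s => (A + - (A * B) * w s) / (sqrt D * sqrt (A ^ 2 * w s ^ 2 + 1))).
  + revert Hroot; apply filter_imp; intros s [HM ->].
    rewrite (normal_of_p_M s).
    replace (A ^ 2 + B ^ 2) with (sqrt D * sqrt D).
    unfold w; specialize (Hsw (w s)); unfold w in Hsw; field.
    repeat split; lra.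
  + rewrite <- (Hv A (- (A * B))).
    apply (Hcont (fun x => (A + - (A * B) * x) /
      (sqrt D * sqrt (A ^ 2 * x ^ 2 + 1)))), Hc0.
Qed.

End Asymptotics.

Lemma system_closest_point (A B : R) (t n : R -> R) :
  A <> 0 -> 0 <= B -> support_system A B t n -> exists a, t a = 0.
Proof.
intros HA HB H.
destruct (tangential_eventually_pos A B t n HA HB H) as [S1 H1].
destruct (tangential_eventually_pos A B _ _ HA HB (system_reverse A B 0 t n H))
  as [S2 H2].
set (b := Rmax 0 S1 + 1); set (a := Rmax 0 S2 + 1).
assert (Hb : 0 < t b).
{ apply H1; unfold b; pose proof (Rmax_r 0 S1); lra. }
assert (Ha : t (- a) < 0).
{ specialize (H2 a); replace (0 - a) with (- a) in H2 by ring.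
  pose proof (Rmax_r 0 S2); unfold a in *; lra. }
destruct (IVT t (- a) b) as [z [_ Hz]]; trivial.
- intros s; destruct (H s) as [h _]; now apply is_derive_continuity_pt in h.
- unfold a, b; pose proof (Rmax_l 0 S1); pose proof (Rmax_l 0 S2); lra.
- now exists z.
Qed.

(** * Embeddedness: comparison of the two arms *)

(** Meant for the squared distance, whose derivative 2 t vanishes at the closest point; hence the
    restriction to s > 0 and x > [f 0]. *)
Lemma inverse_of_increasing (f f' : R -> R) :
  (forall s, is_derive f s (f' s)) -> (forall s, 0 < s -> 0 < f' s) ->
  (forall K, exists s, 0 < s /\ K < f s) ->
  exists g, (forall s, 0 < s -> g (f s) = s) /\
    forall x, f 0 < x -> 0 < g x /\ f (g x) = x /\ is_derive g x (/ f' (g x)).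
Proof.
intros Hf Hpos Hinf.
assert (Hmono : forall a b, 0 <= a -> a < b -> f a < f b).
{ intros a b Ha Hab; apply (derive_pos_lt f f'); trivial.
  intros s Hs; apply Hpos; lra. }
assert (Hinj : forall a b, 0 <= a -> 0 <= b -> f a = f b -> a = b).
{ intros a b Ha Hb Heq; destruct (Rtotal_order a b) as [h | [h | h]]; trivial;
    apply Hmono in h; lra. }
assert (Hcont : forall s, continuity_pt f s)
  by (intros s; apply (is_derive_continuity_pt f s (f' s)), Hf).
(* For x at most [f 0] the implication is vacuous, so that choice yields a total function with
   arbitrary values there. *)
assert (Hex : forall x, exists s, f 0 < x -> 0 < s /\ f s = x).
{ intros x; destruct (Rlt_dec (f 0) x) as [h | h]; [|now exists 0].
  destruct (Hinf x) as [b [Hb Hbx]].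
  destruct (IVT (fun s => f s - x) 0 b) as [z [Hz Hfz]]; try lra.
  - intros s; apply continuity_pt_minus; [apply Hcont|].
    now apply continuity_pt_const; intros ? ?.
  - exists z; intros _; split; [|lra].
    destruct (proj1 Hz) as [hz | <-]; lra. }
set (g := fun x => proj1_sig (constructive_indefinite_description _ (Hex x))).
assert (Hg : forall x, f 0 < x -> 0 < g x /\ f (g x) = x).
{ intros x; unfold g.
  now destruct (constructive_indefinite_description _ (Hex x)). }
clearbody g.
assert (Hgf : forall s, 0 < s -> g (f s) = s).
{ intros s Hs; assert (h : f 0 < f s) by (apply Hmono; lra).
  destruct (Hg _ h) as [h1 h2]; apply Hinj; lra. }
assert (Hgmono : forall x y, f 0 < x -> x <= y -> g x <= g y).
{ intros x y Hx Hxy; destruct (Rle_dec (g x) (g y)) as [h | h]; trivial.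
  destruct (Hg x) as [h1 h2], (Hg y) as [h3 h4]; try lra.
  assert (f (g y) < f (g x)) by (apply Hmono; lra); lra. }
exists g; split; trivial.
intros x Hx; destruct (Hg x Hx) as [Hgx Hfgx]; split; [|split]; trivial.
assert (Hgc : continuity_pt g x).
{ apply (continuity_pt_recip_interv f g (g x / 2) (g x + 1)).
  - lra.
  - intros a b Ha Hab _; apply Hmono; lra.
  - intros y Hy _; apply Hg.
    apply Rlt_le_trans with (2 := Hy), Hmono; lra.
  - intros y Hy Hy'.
    assert (h : f 0 < f (g x / 2)) by (apply Hmono; lra).
    rewrite <- (Hgf (g x / 2)), <- (Hgf (g x + 1)) by lra.
    split; apply Hgmono; lra.
  - intros; apply Hcont.
  - assert (f (g x / 2) < f (g x)) by (apply Hmono; lra).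
    assert (f (g x) < f (g x + 1)) by (apply Hmono; lra); lra. }
assert (Hd : forall a, g ((f 0 + x) / 2) <= a <= g (x + 1) -> derivable_pt f a).
{ intros a _; exists (f' a); now apply is_derive_Reals. }
assert (Hi : g ((f 0 + x) / 2) <= g x <= g (x + 1))
  by (split; apply Hgmono; lra).
assert (He : derive_pt f (g x) (Hd (g x) Hi) = f' (g x))
  by (apply derive_pt_eq_0, is_derive_Reals, Hf).
apply is_derive_Reals; rewrite <- He.
replace (/ derive_pt f (g x) (Hd (g x) Hi))
  with (1 / derive_pt f (g x) (Hd (g x) Hi))
  by (unfold Rdiv; ring).
apply derivable_pt_lim_recip_interv; trivial; try lra.
- intros y Hy; apply (Hg y); lra.
- rewrite He; apply Rgt_not_eq, Hpos, Hgx.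
Qed.

(* [V = tan alpha], where [alpha] is the angle from the position to the outward
   tangent; [x] is the squared distance to the origin. *)
Lemma arm_by_distance (A B : R) (t n phi : R -> R) :
  A <> 0 -> 0 <= B -> support_system A B t n -> t 0 = 0 ->
  (forall s, is_derive phi s (A * t s + B * n s)) ->
  exists g V, (forall s, 0 < s -> g (t s ^ 2 + n s ^ 2) = s) /\
    (forall x, n 0 ^ 2 < x ->
       0 < g x /\ t (g x) ^ 2 + n (g x) ^ 2 = x /\ V x = - n (g x) / t (g x) /\
       is_derive (fun y => phi (g y)) x ((A - B * V x) / 2) /\
       is_derive (fun y => atan (V y)) x
         (A / 2 - V x * (B / 2 + / (2 * x)))) /\
    (forall eps, 0 < eps -> exists x0, n 0 ^ 2 < x0 /\
       forall x, n 0 ^ 2 < x -> x <= x0 -> Rabs (phi (g x) - phi 0) < eps).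
Proof.
intros HA HB H H0 Hphi.
set (f := fun s => t s ^ 2 + n s ^ 2).
assert (Hf : forall s, is_derive f s (2 * t s))
  by apply (system_derive_dist A B t n H).
assert (Ht : forall s, 0 < s -> 0 < t s)
  by now apply (system_tangential_pos A B t n 0).
assert (Hf0 : f 0 = n 0 ^ 2) by (unfold f; rewrite H0; ring).
destruct (inverse_of_increasing f (fun s => 2 * t s)) as [g [Hgf Hg]]; trivial.
{ intros s Hs; specialize (Ht s Hs); lra. }
{ intros K; destruct (dist_eventually A B t n HA HB H K) as [S HS].
  exists (Rmax 0 S + 1); pose proof (Rmax_l 0 S); pose proof (Rmax_r 0 S).
  split; [lra | apply HS; lra]. }
exists g, (fun x => - n (g x) / t (g x)); split; [exact Hgf | split].
- intros x Hx; rewrite <- Hf0 in Hx; destruct (Hg x Hx) as [Hgx [Hfx Hd]].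
  specialize (Ht _ Hgx); destruct (H (g x)) as [Hdt Hdn].
  specialize (Hphi (g x)).
  split; [|split; [|split; [|split]]]; trivial.
  (* Since dx/ds = 2 t, the rate is k / (2 t) = (A t + B n) / (2 t). *)
  + derive_tac; field; lra.
  + assert (Hq : 0 < 1 + (- n (g x) / t (g x)) ^ 2)
      by (pose proof (pow2_ge_0 (- n (g x) / t (g x))); lra).
    replace (/ (2 * x)) with (/ (2 * f (g x))) by now rewrite Hfx.
    derive_tac; try lra.
    unfold f, Rsqr; field; repeat split; try lra; nra.
- intros eps Heps.
  assert (Hc : continuous phi 0) by apply (is_derive_continuous _ _ _ (Hphi 0)).
  apply continuity_pt_filterlim in Hc.
  destruct (Hc eps Heps) as [d [Hd Hdc]].
  assert (Hd2 : f 0 < f (d / 2)).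
  { apply (derive_pos_lt f (fun s => 2 * t s)); [lra | now intros |].
    intros s Hs; specialize (Ht s (proj1 Hs)); lra. }
  exists (f (d / 2)); rewrite <- Hf0; split; trivial.
  intros x Hx Hx'; destruct (Hg x Hx) as [Hgx [Hfx _]].
  assert (Hgd : g x <= d / 2).
  { destruct (Rle_dec (g x) (d / 2)) as [h | h]; trivial.
    assert (f (d / 2) < f (g x)); [|lra].
    apply (derive_pos_lt f (fun s => 2 * t s)); [lra | now intros |].
    intros s Hs; assert (0 < t s) by (apply Ht; lra); lra. }
  apply (Hdc (g x)); split.
  + split; [exact I | lra].
  + simpl; unfold R_dist; rewrite Rabs_pos_eq; lra.
Qed.

(** With [phi] the tangent angle, X exp(-i phi) = t + i n; for t > 0 this point lies in the right
    half-plane and the arctangent is its argument. *)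
Definition polar (t n phi : R -> R) (s : R) : R := phi s + atan (n s / t s).

Lemma polar_cos (t n phi : R -> R) (s : R) : 0 < t s ->
  sqrt (t s ^ 2 + n s ^ 2) * cos (polar t n phi s)
  = t s * cos (phi s) - n s * sin (phi s).
Proof.
intros Ht; unfold polar; rewrite cos_plus, cos_atan, sin_atan.
replace (t s ^ 2 + n s ^ 2) with (t s ^ 2 * (1 + (n s / t s)²))
  by (unfold Rsqr; field; lra).
assert (H : 0 < sqrt (1 + (n s / t s)²))
  by (apply sqrt_lt_R0; pose proof (Rle_0_sqr (n s / t s)); lra).
rewrite sqrt_mult_alt, sqrt_pow2 by (try apply pow2_ge_0; lra).
field; lra.
Qed.

Lemma polar_sin (t n phi : R -> R) (s : R) : 0 < t s ->
  sqrt (t s ^ 2 + n s ^ 2) * sin (polar t n phi s)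
  = t s * sin (phi s) + n s * cos (phi s).
Proof.
intros Ht; unfold polar; rewrite sin_plus, cos_atan, sin_atan.
replace (t s ^ 2 + n s ^ 2) with (t s ^ 2 * (1 + (n s / t s)²))
  by (unfold Rsqr; field; lra).
assert (H : 0 < sqrt (1 + (n s / t s)²))
  by (apply sqrt_lt_R0; pose proof (Rle_0_sqr (n s / t s)); lra).
rewrite sqrt_mult_alt, sqrt_pow2 by (try apply pow2_ge_0; lra).
field; lra.
Qed.

(* The difference [Phi1 - Phi2] of the tangent angles starts at PI and does not
   increase, whereas the difference [H] of the polar angles increases; the two
   differ by [atan V1 - atan V2], which lies in (0, PI). *)
Lemma polar_difference_range (A B d x : R) (Phi1 Phi2 V1 V2 : R -> R) :
  0 <= B -> 0 <= d -> d < x ->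
  (forall y, d < y -> V2 y < V1 y) ->
  (forall y, d < y ->
     is_derive Phi1 y ((A - B * V1 y) / 2) /\
     is_derive Phi2 y ((A - B * V2 y) / 2) /\
     is_derive (fun y => atan (V1 y)) y (A / 2 - V1 y * (B / 2 + / (2 * y))) /\
     is_derive (fun y => atan (V2 y)) y (A / 2 - V2 y * (B / 2 + / (2 * y)))) ->
  (forall eps, 0 < eps -> exists x0, d < x0 /\
     forall y, d < y -> y <= x0 -> Rabs (Phi1 y - Phi2 y - PI) < eps) ->
  0 < (Phi1 x - atan (V1 x)) - (Phi2 x - atan (V2 x)) < PI.
Proof.
intros HB Hd Hx HV Hder Hlim.
set (E := fun y => Phi1 y - Phi2 y).
set (H := fun y => (Phi1 y - atan (V1 y)) - (Phi2 y - atan (V2 y))).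
assert (HEd : forall y z, d < y -> y <= z -> E z <= E y).
{ intros y z Hy Hyz.
  assert (0 * (z - y) <= - E z - - E y); [|lra].
  apply (derive_le_lower (fun y => - E y) (fun y => B * (V1 y - V2 y) / 2));
    trivial.
  - intros c Hc; destruct (Hder c) as [h1 [h2 _]]; [lra|].
    unfold E; derive_tac; field.
  - intros c Hc; assert (V2 c < V1 c) by (apply HV; lra).
    assert (0 <= B * (V1 c - V2 c)) by (apply Rmult_le_pos; lra); lra. }
(* In the derivative of each polar angle [Phi - atan V] the terms in A and B cancel and V / (2 y) is
   left. *)
assert (HHi : forall y z, d < y -> y < z -> H y < H z).
{ intros y z Hy Hyz.
  apply (derive_pos_lt H (fun y => (V1 y - V2 y) / (2 * y))); trivial.
  - intros c Hc; destruct (Hder c) as [h1 [h2 [h3 h4]]]; [lra|].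
    unfold H.
    replace ((V1 c - V2 c) / (2 * c)) with
      (((A - B * V1 c) / 2 - (A / 2 - V1 c * (B / 2 + / (2 * c))))
       - ((A - B * V2 c) / 2 - (A / 2 - V2 c * (B / 2 + / (2 * c)))))
      by (field; lra).
    apply (is_derive_minus (fun y => Phi1 y - atan (V1 y))
                           (fun y => Phi2 y - atan (V2 y))).
    + now apply (is_derive_minus Phi1 (fun y => atan (V1 y))).
    + now apply (is_derive_minus Phi2 (fun y => atan (V2 y))).
  - intros c Hc; assert (V2 c < V1 c) by (apply HV; lra).
    apply Rdiv_lt_0_compat; lra. }
assert (HEle : E x <= PI).
{ apply Rnot_lt_le; intros h.
  destruct (Hlim (E x - PI)) as [x0 [Hx0 Hy]]; [lra|].
  specialize (Hy (Rmin x0 x) (Rmin_glb_lt _ _ _ Hx0 Hx) (Rmin_l _ _)).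
  pose proof (HEd (Rmin x0 x) x (Rmin_glb_lt _ _ _ Hx0 Hx) (Rmin_r _ _)).
  apply Rabs_def2 in Hy; unfold E in *; lra. }
assert (Hat : forall y, d < y -> 0 < atan (V1 y) - atan (V2 y) < PI).
{ intros y Hy; pose proof (atan_increasing _ _ (HV y Hy)).
  pose proof (atan_bound (V1 y)); pose proof (atan_bound (V2 y)); lra. }
(* The arctangents differ by less than PI, so H > E - PI, and E - PI tends to 0 at d. As H
   increases, a negative value of H would contradict this near d. *)
assert (HHge : forall z, d < z -> 0 <= H z).
{ intros z Hz; apply Rnot_lt_le; intros h.
  destruct (Hlim (- H z)) as [x0 [Hx0 Hy]]; [lra|].
  assert (Hz' : d < (d + z) / 2) by lra.
  set (y := Rmin x0 ((d + z) / 2)).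
  assert (Hdy : d < y) by now apply Rmin_glb_lt.
  specialize (Hy y Hdy (Rmin_l _ _)).
  assert (H y < H z).
  { apply HHi; trivial; unfold y; pose proof (Rmin_r x0 ((d + z) / 2)); lra. }
  specialize (Hat y Hdy); apply Rabs_def2 in Hy; unfold H in *; lra. }
change (0 < H x < PI); split.
- apply Rle_lt_trans with (H ((d + x) / 2)); [apply HHge | apply HHi]; lra.
- specialize (Hat x Hx); unfold H, E in *; lra.
Qed.

Lemma nonvanishing_sign (f : R -> R) (d : R) :
  (forall y, d < y -> continuity_pt f y) ->
  (forall y, d < y -> f y <> 0) ->
  (forall y, d < y -> 0 < f y) \/ (forall y, d < y -> f y < 0).
Proof.
intros Hf Hnz.
assert (Hno : forall a b, d < a -> d < b -> f a < 0 -> ~ 0 < f b).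
{ intros a b Ha Hb Hfa Hfb.
  destruct (Rtotal_order a b) as [h | [-> | h]]; [| lra |].
  - destruct (IVT_interv f a b) as [z [Hz Hfz]]; trivial.
    + intros c Hc; apply Hf; lra.
    + apply (Hnz z); trivial; lra.
  - destruct (IVT_interv (fun y => - f y) b a) as [z [Hz Hfz]]; try lra.
    + intros c Hc; apply continuity_pt_opp, Hf; lra.
    + apply (Hnz z); lra. }
destruct (Rlt_dec (f (d + 1)) 0) as [h | h].
- right; intros y Hy; pose proof (Hnz y Hy).
  assert (~ 0 < f y) by (apply (Hno (d + 1)); trivial; lra); lra.
- left; intros y Hy; pose proof (Hnz y Hy); pose proof (Hnz (d + 1)).
  assert (~ f y < 0); [|lra].
  intros h'; apply (Hno y (d + 1)); lra.
Qed.

(** In the application the second arm is traversed backwards but keeps the tangent angle of the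
    original curve, so both angles start equal and [polar] measures the angle of the opposite point
    -X on it. A crossing of the arms would therefore be a difference of PI modulo 2 PI, which the
    strict bounds exclude. *)
Lemma arms_polar_difference (A B : R) (t1 n1 phi1 t2 n2 phi2 : R -> R) :
  A <> 0 -> 0 <= B -> support_system A B t1 n1 -> support_system A B t2 n2 ->
  t1 0 = 0 -> t2 0 = 0 -> n1 0 ^ 2 = n2 0 ^ 2 -> n1 0 <> n2 0 ->
  (forall s, is_derive phi1 s (A * t1 s + B * n1 s)) ->
  (forall s, is_derive phi2 s (A * t2 s + B * n2 s)) ->
  phi1 0 = phi2 0 ->
  forall s1 s2, 0 < s1 -> 0 < s2 ->
    t1 s1 ^ 2 + n1 s1 ^ 2 = t2 s2 ^ 2 + n2 s2 ^ 2 ->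
    0 < Rabs (polar t1 n1 phi1 s1 - polar t2 n2 phi2 s2) < PI.
Proof.
intros HA HB H1 H2 H10 H20 Hd Hne Hphi1 Hphi2 Hphi0 s1 s2 Hs1 Hs2 Heq.
destruct (arm_by_distance A B t1 n1 phi1) as [g1 [V1 [Hg1 [Hx1 Hl1]]]]; trivial.
destruct (arm_by_distance A B t2 n2 phi2) as [g2 [V2 [Hg2 [Hx2 Hl2]]]]; trivial.
rewrite Hd in Hx1, Hl1; set (d := n2 0 ^ 2) in *.
assert (Ht1 : forall s, 0 < s -> 0 < t1 s)
  by now apply (system_tangential_pos A B t1 n1 0).
assert (Ht2 : forall s, 0 < s -> 0 < t2 s)
  by now apply (system_tangential_pos A B t2 n2 0).
(* Equal x and equal V give equal (t, n), so the two solutions are translates of each other. Each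
   has a single zero of t, at parameter 0, so the translation is trivial and [n1 0 = n2 0], against
   the hypothesis. *)
assert (HVne : forall x, d < x -> V1 x <> V2 x).
{ intros x Hx HV.
  destruct (Hx1 x Hx) as [Hp1 [Hf1 [HV1 _]]], (Hx2 x Hx) as [Hp2 [Hf2 [HV2 _]]].
  pose proof (Ht1 _ Hp1) as hp1; pose proof (Ht2 _ Hp2) as hp2.
  assert (Hn1 : n1 (g1 x) = - V1 x * t1 (g1 x)) by (rewrite HV1; field; lra).
  assert (Hn2 : n2 (g2 x) = - V2 x * t2 (g2 x)) by (rewrite HV2; field; lra).
  assert (Ht : t1 (g1 x) = t2 (g2 x)).
  { rewrite <- HV in Hn2; rewrite Hn1 in Hf1; rewrite Hn2 in Hf2.
    assert (Hsq : (t1 (g1 x) - t2 (g2 x)) * ((t1 (g1 x) + t2 (g2 x))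
                   * (1 + V1 x ^ 2)) = 0) by lra.
    apply Rmult_integral in Hsq; destruct Hsq as [Hsq | Hsq]; [lra|].
    assert (0 < (t1 (g1 x) + t2 (g2 x)) * (1 + V1 x ^ 2)); [|lra].
    apply Rmult_lt_0_compat; [lra | pose proof (pow2_ge_0 (V1 x)); lra]. }
  assert (Hn : n1 (g1 x) = n2 (g2 x)) by now rewrite Hn1, Hn2, HV, Ht.
  pose proof (system_unique A B _ _ _ _ 0
    (system_shift A B (g1 x) t1 n1 H1) (system_shift A B (g2 x) t2 n2 H2)) as Hu.
  cbv beta in Hu; rewrite !Rplus_0_r in Hu; specialize (Hu Ht Hn (- g2 x)).
  replace (g2 x + - g2 x) with 0 in Hu by ring; rewrite H20 in Hu.
  assert (Hg : g1 x + - g2 x = 0).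
  { destruct (Rtotal_order (g1 x + - g2 x) 0) as [h | [h | h]]; trivial.
    - apply (system_tangential_neg A B t1 n1 0 HB H1 H10) in h; lra.
    - apply Ht1 in h; lra. }
  rewrite Hg in Hu; lra. }
assert (Hgs1 : g1 (t1 s1 ^ 2 + n1 s1 ^ 2) = s1) by now apply Hg1.
assert (Hgs2 : g2 (t1 s1 ^ 2 + n1 s1 ^ 2) = s2) by now rewrite Heq; apply Hg2.
set (x := t1 s1 ^ 2 + n1 s1 ^ 2) in *.
assert (Hx : d < x).
{ unfold x; rewrite <- Hd.
  replace (n1 0 ^ 2) with (t1 0 ^ 2 + n1 0 ^ 2) by (rewrite H10; ring).
  apply (derive_pos_lt (fun s => t1 s ^ 2 + n1 s ^ 2) (fun s => 2 * t1 s));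
    trivial.
  - intros s _; now apply (system_derive_dist A B).
  - intros s Hs; specialize (Ht1 s (proj1 Hs)); lra. }
assert (Hpol : polar t1 n1 phi1 s1 - polar t2 n2 phi2 s2
   = (phi1 (g1 x) - atan (V1 x)) - (phi2 (g2 x) - atan (V2 x))).
{ destruct (Hx1 x Hx) as [_ [_ [-> _]]], (Hx2 x Hx) as [_ [_ [-> _]]].
  rewrite Hgs1, Hgs2; unfold polar, Rdiv.
  rewrite <- !Ropp_mult_distr_l, !atan_opp; ring. }
assert (Hd0 : 0 <= d) by apply pow2_ge_0.
assert (Hlim : forall eps, 0 < eps -> exists x0, d < x0 /\
   forall y, d < y -> y <= x0 -> Rabs (phi1 (g1 y) - phi2 (g2 y)) < eps).
{ intros eps He.
  destruct (Hl1 (eps / 2)) as [a1 [Ha1 Hb1]]; [lra|].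
  destruct (Hl2 (eps / 2)) as [a2 [Ha2 Hb2]]; [lra|].
  exists (Rmin a1 a2); split; [now apply Rmin_glb_lt|].
  intros y Hy Hy'; pose proof (Rmin_l a1 a2); pose proof (Rmin_r a1 a2).
  specialize (Hb1 y Hy); specialize (Hb2 y Hy).
  replace (phi1 (g1 y) - phi2 (g2 y))
    with ((phi1 (g1 y) - phi1 0) - (phi2 (g2 y) - phi2 0)) by lra.
  eapply Rle_lt_trans; [apply Rabs_triang|]; rewrite Rabs_Ropp; lra. }
destruct (nonvanishing_sign (fun y => atan (V1 y) - atan (V2 y)) d)
  as [Hs | Hs].
- intros y Hy; apply continuity_pt_minus.
  + now destruct (Hx1 y Hy) as [_ [_ [_ [_ h]]]];
      apply is_derive_continuity_pt in h.
  + now destruct (Hx2 y Hy) as [_ [_ [_ [_ h]]]];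
      apply is_derive_continuity_pt in h.
- intros y Hy h; apply (HVne y Hy).
  rewrite <- (tan_atan (V1 y)), <- (tan_atan (V2 y)); f_equal; lra.
- assert (HV : forall y, d < y -> V2 y < V1 y).
  { intros y Hy; specialize (Hs y Hy).
    destruct (Rtotal_order (V1 y) (V2 y)) as [h | [h | h]]; trivial.
    - apply atan_increasing in h; lra.
    - now apply HVne in h. }
  (* Turning by PI the arm with the larger V makes the angles start at difference PI, as
     [polar_difference_range] requires; the other case exchanges the arms. *)
  assert (H : 0 < ((phi1 (g1 x) + PI) - atan (V1 x))
                  - (phi2 (g2 x) - atan (V2 x)) < PI).
  { apply (polar_difference_range A B d x (fun y => phi1 (g1 y) + PI)
      (fun y => phi2 (g2 y)) V1 V2); trivial.
    - intros y Hy; destruct (Hx1 y Hy) as [_ [_ [_ [h1 h2]]]].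
      destruct (Hx2 y Hy) as [_ [_ [_ [h3 h4]]]].
      split; [|split; [|split]]; trivial.
      replace ((A - B * V1 y) / 2) with ((A - B * V1 y) / 2 + 0) by ring.
      apply (is_derive_plus (fun y => phi1 (g1 y)) (fun _ => PI)); trivial.
      apply (is_derive_const PI).
    - intros eps He; destruct (Hlim eps He) as [x0 [Hx0 h]].
      exists x0; split; trivial; intros y Hy Hy'.
      replace (phi1 (g1 y) + PI - phi2 (g2 y) - PI)
        with (phi1 (g1 y) - phi2 (g2 y)) by ring.
      now apply h. }
  rewrite Hpol, Rabs_left; lra.
- assert (HV : forall y, d < y -> V1 y < V2 y).
  { intros y Hy; specialize (Hs y Hy).
    destruct (Rtotal_order (V1 y) (V2 y)) as [h | [h | h]]; trivial.
    - now apply HVne in h.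
    - apply atan_increasing in h; lra. }
  assert (H : 0 < ((phi2 (g2 x) + PI) - atan (V2 x))
                  - (phi1 (g1 x) - atan (V1 x)) < PI).
  { apply (polar_difference_range A B d x (fun y => phi2 (g2 y) + PI)
      (fun y => phi1 (g1 y)) V2 V1); trivial.
    - intros y Hy; destruct (Hx1 y Hy) as [_ [_ [_ [h1 h2]]]].
      destruct (Hx2 y Hy) as [_ [_ [_ [h3 h4]]]].
      split; [|split; [|split]]; trivial.
      replace ((A - B * V2 y) / 2) with ((A - B * V2 y) / 2 + 0) by ring.
      apply (is_derive_plus (fun y => phi2 (g2 y)) (fun _ => PI)); trivial.
      apply (is_derive_const PI).
    - intros eps He; destruct (Hlim eps He) as [x0 [Hx0 h]].
      exists x0; split; trivial; intros y Hy Hy'.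
      replace (phi2 (g2 y) + PI - phi1 (g1 y) - PI)
        with (- (phi1 (g1 y) - phi2 (g2 y))) by ring.
      rewrite Rabs_Ropp; now apply h. }
  rewrite Hpol, Rabs_pos_eq; lra.
Qed.

(** * Curves and frames *)

(** An inductive form of n-fold differentiability: sums and products follow by induction, without a
    formula for the higher derivatives of a product. *)
Fixpoint Cn (n : nat) (f : R -> R) : Prop :=
  match n with
  | O => True
  | S m => exists g, (forall u, is_derive f u (g u)) /\ Cn m g
  end.

Lemma Cn_pred (n : nat) (f : R -> R) : Cn (S n) f -> Cn n f.
Proof.
revert f; induction n as [|n IH]; intros f; [easy|].
intros [g [Hg H]]; exists g; split; [exact Hg | now apply IH].
Qed.

Lemma Cn_const (n : nat) (c : R) : Cn n (fun _ => c).
Proof.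
revert c; induction n as [|n IH]; intros c; [easy|].
exists (fun _ => 0); split; [intros u; apply (is_derive_const c) | apply IH].
Qed.

Lemma Cn_plus (n : nat) (f g : R -> R) :
  Cn n f -> Cn n g -> Cn n (fun u => f u + g u).
Proof.
revert f g; induction n as [|n IH]; intros f g; [easy|].
intros [f' [Hf H]] [g' [Hg H']]; exists (fun u => f' u + g' u); split.
- intros u; now apply (is_derive_plus f g).
- now apply IH.
Qed.

Lemma Cn_mult (n : nat) (f g : R -> R) :
  Cn n f -> Cn n g -> Cn n (fun u => f u * g u).
Proof.
revert f g; induction n as [|n IH]; intros f g; [easy|].
intros Hf0 Hg0; pose proof (Cn_pred _ _ Hf0); pose proof (Cn_pred _ _ Hg0).
destruct Hf0 as [f' [Hf H1]], Hg0 as [g' [Hg H2]].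
exists (fun u => f' u * g u + f u * g' u); split.
- intros u; specialize (Hf u); specialize (Hg u); derive_tac; ring.
- apply Cn_plus; now apply IH.
Qed.

Lemma Cn_opp (n : nat) (f : R -> R) : Cn n f -> Cn n (fun u => - f u).
Proof.
revert f; induction n as [|n IH]; intros f; [easy|].
intros [f' [Hf H]]; exists (fun u => - f' u); split.
- intros u; now apply (is_derive_opp f).
- now apply IH.
Qed.

Lemma Derive_n_Derive (f : R -> R) (n : nat) (u : R) :
  Derive_n (Derive f) n u = Derive_n f (S n) u.
Proof.
replace (S n) with (n + 1)%nat by lia.
exact (Derive_n_comp f n 1 u).
Qed.

Lemma smooth_fun_Cn (f : R -> R) : smooth_fun f <-> forall n, Cn n f.
Proof.
split.
- intros Hf n; revert f Hf; induction n as [|n IH]; intros f Hf; [easy|].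
  exists (Derive f); split.
  + intros u; apply Derive_correct, (Hf 1%nat).
  + apply IH; intros [|m] u; [exact I|].
    apply ex_derive_ext with (Derive_n f (S m)).
    * intros v; symmetry; apply Derive_n_Derive.
    * apply (Hf (S (S m))).
- intros Hf [|n] u; [exact I|]; simpl.
  generalize (Hf (S n)); clear Hf; revert f u.
  induction n as [|n IH]; intros f u [g [Hg H]].
  + now exists (g u).
  + apply ex_derive_ext with (Derive_n g n); [|now apply IH].
    intros v; rewrite <- Derive_n_Derive.
    apply Derive_n_ext; intros w; symmetry; now apply is_derive_unique.
Qed.

Lemma smooth_fun_linear (f g : R -> R) (a b : R) :
  smooth_fun f -> smooth_fun g -> smooth_fun (fun u => a * f u + b * g u).
Proof.
intros Hf Hg; apply smooth_fun_Cn; intros n.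
apply Cn_plus; (apply Cn_mult; [apply Cn_const | now apply smooth_fun_Cn]).
Qed.

Lemma Cdiv_real (a b r : R) : r <> 0 -> ((a, b) / RtoC r)%C = (a / r, b / r).
Proof.
intros Hr; unfold Cdiv, Cinv, Cmult, RtoC; simpl; f_equal; field; trivial.
Qed.

(** Constant speed [r] covers both uses: [r = 1] for a solution, and the dilation factor for a time
    slice of the flow. *)
Lemma curve_geometry (c : R -> C) (r : R) (p q p' q' : R -> R) :
  0 < r ->
  (forall u, is_derive (fun v => Re (c v)) u (r * p u)) ->
  (forall u, is_derive (fun v => Im (c v)) u (r * q u)) ->
  (forall u, is_derive p u (p' u)) -> (forall u, is_derive q u (q' u)) ->
  (forall u, p u ^ 2 + q u ^ 2 = 1) ->
  forall u, Cmod (deriveC c u) = r /\ tangent c u = (p u, q u) /\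
    normal c u = (- q u, p u) /\
    curvature c u = (q' u * p u - p' u * q u) / r.
Proof.
intros Hr Hx Hy Hp Hq Hpq.
assert (Hd : forall u, deriveC c u = (r * p u, r * q u)).
{ intros u; unfold deriveC; f_equal; now apply is_derive_unique. }
assert (Hm : forall u, Cmod (deriveC c u) = r).
{ intros u; rewrite Hd; unfold Cmod; simpl fst; simpl snd.
  replace ((r * p u) ^ 2 + (r * q u) ^ 2) with (r ^ 2)
    by (rewrite <- (Rmult_1_r (r ^ 2)), <- (Hpq u); ring).
  now apply sqrt_pow2, Rlt_le. }
assert (Ht : forall u, tangent c u = (p u, q u)).
{ intros u; unfold tangent, arc_derive; rewrite Hm, Hd, Cdiv_real by lra.
  f_equal; field; lra. }
assert (Hn : forall u, normal c u = (- q u, p u)).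
{ intros u; unfold normal; rewrite Ht; unfold Cmult, Ci; simpl; f_equal; ring. }
intros u; repeat split; trivial.
unfold curvature; rewrite Hn; unfold arc_derive; rewrite Hm.
replace (deriveC (tangent c) u) with (p' u, q' u).
- rewrite Cdiv_real by lra.
  unfold dot, Cmult, Cconj, Re; simpl; field; lra.
- unfold deriveC; f_equal; symmetry; apply is_derive_unique.
  + apply is_derive_ext with p; trivial; intros v; now rewrite Ht.
  + apply is_derive_ext with q; trivial; intros v; now rewrite Ht.
Qed.

(** [tau] and [nu] are <X,T> and <X,N> for X = (x, y), T = (p, q) and N = (-q, p). *)
Definition tau (x y p q : R -> R) (s : R) : R := x s * p s + y s * q s.
Definition nu (x y p q : R -> R) (s : R) : R := y s * p s - x s * q s.

(** The Frenet equations with the curvature replaced by A <X,T> + B <X,N>: a first-order system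
    equivalent to [solution], by [frame_solution] and [solution_frame]. *)
Definition frame (A B : R) (x y p q : R -> R) : Prop :=
  forall s,
    let k := A * tau x y p q s + B * nu x y p q s in
    is_derive x s (p s) /\ is_derive y s (q s) /\
    is_derive p s (- (k * q s)) /\ is_derive q s (k * p s) /\
    p s ^ 2 + q s ^ 2 = 1.

Lemma frame_solution (A B : R) (x y p q : R -> R) :
  frame A B x y p q ->
  let X := fun s => (x s, y s) : C in
  solution A B X /\
  forall s, tangent X s = (p s, q s) /\ normal X s = (- q s, p s) /\
    curvature X s = A * tau x y p q s + B * nu x y p q s.
Proof.
intros H X.
(* The transports rewrite the derivative [p s] as [1 * p s], the form used for speed 1. *)
assert (Hg := curve_geometry X 1 p q _ _ Rlt_0_1
  (fun s => eq_rect _ (is_derive x s) (proj1 (H s)) _ (eq_sym (Rmult_1_l _)))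
  (fun s => eq_rect _ (is_derive y s) (proj1 (proj2 (H s))) _
              (eq_sym (Rmult_1_l _)))
  (fun s => proj1 (proj2 (proj2 (H s))))
  (fun s => proj1 (proj2 (proj2 (proj2 (H s)))))
  (fun s => proj2 (proj2 (proj2 (proj2 (H s)))))).
assert (Hk : forall s, tangent X s = (p s, q s) /\ normal X s = (- q s, p s) /\
    curvature X s = A * tau x y p q s + B * nu x y p q s).
{ intros s; destruct (Hg s) as [_ [-> [-> ->]]]; repeat split.
  destruct (H s) as [_ [_ [_ [_ h]]]].
  rewrite Rdiv_1_r.
  transitivity ((A * tau x y p q s + B * nu x y p q s) * (p s ^ 2 + q s ^ 2));
    [ring | rewrite h; ring]. }
split; trivial; split; [|split].
(* Bootstrapping: the derivatives of the four functions are polynomials in them, so each gains one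
   order at every step. *)
- assert (Hc : forall n, Cn n x /\ Cn n y /\ Cn n p /\ Cn n q).
  { induction n as [|n [IHx [IHy [IHp IHq]]]]; [now simpl|].
    assert (Hkn : Cn n (fun s => A * tau x y p q s + B * nu x y p q s)).
    { unfold tau, nu, Rminus.
      repeat (apply Cn_plus || apply Cn_opp || apply Cn_mult || apply Cn_const
              || assumption). }
    split; [|split; [|split]].
    - exists p; split; trivial; intros s; apply H.
    - exists q; split; trivial; intros s; apply H.
    - exists (fun s => - ((A * tau x y p q s + B * nu x y p q s) * q s)).
      split; [intros s; apply H | now apply Cn_opp, Cn_mult].
    - exists (fun s => (A * tau x y p q s + B * nu x y p q s) * p s).
      split; [intros s; apply H | now apply Cn_mult]. }
  split; apply smooth_fun_Cn; intros n; apply Hc.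
- intros s; apply Hg.
- intros s; destruct (Hk s) as [-> [-> ->]].
  unfold dot, tau, nu, Cmult, Cconj, Re; simpl; ring.
Qed.

(** Differentiating |T|^2 = 1 shows that T' is orthogonal to T, hence T' = k N. *)
Lemma solution_frame (A B : R) (X : R -> C) :
  solution A B X ->
  exists x y p q, frame A B x y p q /\ X = (fun s => (x s, y s)).
Proof.
intros [[HSx HSy] [HU HE]].
set (x := fun s => Re (X s)); set (y := fun s => Im (X s)).
set (p := Derive x); set (q := Derive y).
exists x, y, p, q.
assert (Hx : forall s, is_derive x s (1 * p s)).
{ intros s; rewrite Rmult_1_l; apply Derive_correct, (HSx 1%nat). }
assert (Hy : forall s, is_derive y s (1 * q s)).
{ intros s; rewrite Rmult_1_l; apply Derive_correct, (HSy 1%nat). }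
assert (Hp : forall s, is_derive p s (Derive p s))
  by (intros s; apply Derive_correct, (HSx 2%nat)).
assert (Hq : forall s, is_derive q s (Derive q s))
  by (intros s; apply Derive_correct, (HSy 2%nat)).
assert (Hpq : forall s, p s ^ 2 + q s ^ 2 = 1).
{ intros s; specialize (HU s); unfold Cmod, deriveC in HU; simpl in HU.
  rewrite <- (sqrt_def (p s ^ 2 + q s ^ 2)).
  - change (sqrt (p s ^ 2 + q s ^ 2) = 1) in HU; rewrite HU; ring.
  - pose proof (pow2_ge_0 (p s)); pose proof (pow2_ge_0 (q s)); lra. }
split.
- intros s k.
  destruct (curve_geometry X 1 p q _ _ Rlt_0_1 Hx Hy Hp Hq Hpq s)
    as [_ [Ht [Hn Hk]]].
  assert (Hkk : k = Derive q s * p s - Derive p s * q s).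
  { rewrite Rdiv_1_r in Hk; rewrite <- Hk, <- HE, Ht, Hn.
    unfold k, tau, nu, dot, Cmult, Cconj, x, y, Re, Im; simpl; ring. }
  assert (Horth : p s * Derive p s + q s * Derive q s = 0).
  { assert (Hd : is_derive (fun s => p s ^ 2 + q s ^ 2) s
      (2 * (p s * Derive p s + q s * Derive q s))).
    { specialize (Hp s); specialize (Hq s).
      generalize dependent (Derive p s); generalize dependent (Derive q s).
      clearbody p q; intros; derive_tac; ring. }
    assert (Hd' : is_derive (fun s => p s ^ 2 + q s ^ 2) s 0).
    { apply is_derive_ext with (fun _ => 1); [now intros|].
      apply (is_derive_const 1). }
    apply is_derive_unique in Hd; apply is_derive_unique in Hd'; lra. }
  specialize (Hx s); specialize (Hy s); rewrite Rmult_1_l in Hx, Hy.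
  split; [|split; [|split; [|split]]]; trivial.
  + replace (- (k * q s)) with (Derive p s); trivial.
    rewrite Hkk; rewrite <- (Rmult_1_r (Derive p s)) at 1; rewrite <- (Hpq s).
    replace (Derive p s * (p s ^ 2 + q s ^ 2))
      with (p s * (p s * Derive p s + q s * Derive q s)
            - (Derive q s * p s - Derive p s * q s) * q s) by ring.
    rewrite Horth; ring.
  + replace (k * p s) with (Derive q s); trivial.
    rewrite Hkk; rewrite <- (Rmult_1_r (Derive q s)) at 1; rewrite <- (Hpq s).
    replace (Derive q s * (p s ^ 2 + q s ^ 2))
      with (q s * (p s * Derive p s + q s * Derive q s)
            + (Derive q s * p s - Derive p s * q s) * p s) by ring.
    rewrite Horth; ring.
- apply functional_extensionality; intros s; apply surjective_pairing.
Qed.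

Section Frame.

Variables (A B : R) (x y p q : R -> R).
Hypothesis H : frame A B x y p q.

Lemma frame_system : support_system A B (tau x y p q) (nu x y p q).
Proof.
intros s; destruct (H s) as [hx [hy [hp [hq hu]]]].
set (k := A * tau x y p q s + B * nu x y p q s) in *; clearbody k.
replace (1 + k * nu x y p q s) with
  (p s ^ 2 + q s ^ 2 + k * nu x y p q s) by now rewrite hu.
unfold tau, nu in *; split; derive_tac; ring.
Qed.

(** Travelling backwards keeps the positions and changes the sign of T and N. Thus [tau], [nu] and
    the curvature all change sign, and the equation survives. *)
Lemma frame_reverse (a : R) :
  frame A B (fun s => x (a - s)) (fun s => y (a - s))
    (fun s => - p (a - s)) (fun s => - q (a - s)).
Proof.
intros s k; destruct (H (a - s)) as [hx [hy [hp [hq hu]]]].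
replace (A * tau x y p q (a - s) + B * nu x y p q (a - s)) with (- k)
  in hp, hq by (unfold k, tau, nu; ring).
clearbody k.
split; [|split; [|split; [|split]]]; try (derive_tac; ring).
rewrite <- hu; ring.
Qed.

Lemma frame_shift (a : R) :
  frame A B (fun s => x (a + s)) (fun s => y (a + s))
    (fun s => p (a + s)) (fun s => q (a + s)).
Proof.
intros s k; destruct (H (a + s)) as [hx [hy [hp [hq hu]]]].
change (A * tau x y p q (a + s) + B * nu x y p q (a + s)) with k in hp, hq.
clearbody k.
split; [|split; [|split; [|split]]]; trivial; derive_tac; ring.
Qed.

Lemma frame_x (s : R) :
  x s = tau x y p q s * p s - nu x y p q s * q s.
Proof.
destruct (H s) as [_ [_ [_ [_ hu]]]].
rewrite <- (Rmult_1_r (x s)), <- hu; unfold tau, nu; ring.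
Qed.

Lemma frame_y (s : R) :
  y s = tau x y p q s * q s + nu x y p q s * p s.
Proof.
destruct (H s) as [_ [_ [_ [_ hu]]]].
rewrite <- (Rmult_1_r (y s)), <- hu; unfold tau, nu; ring.
Qed.

Lemma frame_dist (s : R) :
  x s ^ 2 + y s ^ 2 = tau x y p q s ^ 2 + nu x y p q s ^ 2.
Proof.
destruct (H s) as [_ [_ [_ [_ hu]]]].
rewrite <- (Rmult_1_r (x s ^ 2 + _)), <- hu; unfold tau, nu; ring.
Qed.

End Frame.

Lemma unit_angle (a b : R) :
  a ^ 2 + b ^ 2 = 1 -> exists theta, a = cos theta /\ b = sin theta.
Proof.
intros H.
assert (Ha : -1 <= a <= 1) by (pose proof (pow2_ge_0 b); split; nra).
assert (Hs : b ^ 2 = 1 - a²) by (unfold Rsqr; lra).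
destruct (Rle_dec 0 b) as [h | h].
- exists (acos a); rewrite cos_acos, sin_acos, <- Hs, sqrt_pow2; auto.
- exists (- acos a); rewrite cos_neg, sin_neg, cos_acos, sin_acos, <- Hs; auto.
  replace (b ^ 2) with ((- b) ^ 2) by ring; rewrite sqrt_pow2; [|lra].
  split; ring.
Qed.

(** The angle is taken as a primitive of the curvature. Then <T, exp(i phi)> is constant, equal to
    1, and two unit vectors with inner product 1 coincide; this replaces a lifting argument. *)
Lemma frame_angle (A B : R) (x y p q : R -> R) :
  frame A B x y p q ->
  exists phi,
    (forall s, is_derive phi s (A * tau x y p q s + B * nu x y p q s)) /\
    forall s, p s = cos (phi s) /\ q s = sin (phi s).
Proof.
intros H.
destruct (unit_angle (p 0) (q 0)) as [th [Hp0 Hq0]]; [apply H|].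
destruct (continuous_primitive
  (fun s => A * tau x y p q s + B * nu x y p q s) th) as [phi [Hphi0 Hphi]].
{ intros s; destruct (frame_system A B x y p q H s) as [h1 h2].
  apply (@ex_derive_continuous R_AbsRing R_NormedModule).
  auto_derive; repeat split; trivial; eexists; eassumption. }
exists phi; split; trivial; intros s.
assert (Hcd : forall s,
  is_derive (fun s => p s * cos (phi s) + q s * sin (phi s)) s 0).
{ intros r; destruct (H r) as [_ [_ [hp [hq _]]]]; specialize (Hphi r).
  derive_tac; ring. }
assert (Hc : p s * cos (phi s) + q s * sin (phi s) = 1).
{ rewrite (derive_zero_const _ Hcd s 0), Hphi0, <- Hp0, <- Hq0.
  destruct (H 0) as [_ [_ [_ [_ h]]]]; lra. }
destruct (H s) as [_ [_ [_ [_ h]]]].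
pose proof (sin2_cos2 (phi s)) as h'; unfold Rsqr in h'.
assert (h2 : (p s - cos (phi s)) ^ 2 + (q s - sin (phi s)) ^ 2 = 0) by nra.
pose proof (pow2_ge_0 (p s - cos (phi s))).
pose proof (pow2_ge_0 (q s - sin (phi s))).
split; apply Rminus_diag_uniq, Rsqr_0_uniq; unfold Rsqr; lra.
Qed.

(** The functions [tau] and [nu] of both curves agree everywhere, so the curvatures do. Hence T2
    conj(T1) = c + i d is constant, and it is the rotation, since X = (tau + i nu) T recovers the
    position. *)
Lemma frame_unique (A B : R) (x1 y1 p1 q1 x2 y2 p2 q2 : R -> R) (a : R) :
  frame A B x1 y1 p1 q1 -> frame A B x2 y2 p2 q2 ->
  tau x1 y1 p1 q1 a = tau x2 y2 p2 q2 a ->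
  nu x1 y1 p1 q1 a = nu x2 y2 p2 q2 a ->
  exists c d, c ^ 2 + d ^ 2 = 1 /\
    c = p1 a * p2 a + q1 a * q2 a /\
    d = p1 a * q2 a - q1 a * p2 a /\
    forall s, x2 s = c * x1 s - d * y1 s /\ y2 s = d * x1 s + c * y1 s.
Proof.
intros H1 H2 Ht Hn.
assert (Hs := system_unique A B _ _ _ _ a (frame_system _ _ _ _ _ _ H1)
  (frame_system _ _ _ _ _ _ H2) Ht Hn).
set (c := fun s => p1 s * p2 s + q1 s * q2 s).
set (d := fun s => p1 s * q2 s - q1 s * p2 s).
assert (Hu : forall s, p1 s ^ 2 + q1 s ^ 2 = 1) by (intros s; apply H1).
assert (Hu2 : forall s, p2 s ^ 2 + q2 s ^ 2 = 1) by (intros s; apply H2).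
assert (Hc : forall s, is_derive c s 0 /\ is_derive d s 0).
{ intros s; destruct (H1 s) as [_ [_ [h1 [h2 _]]]].
  destruct (H2 s) as [_ [_ [h3 [h4 _]]]]; destruct (Hs s) as [Hts Hns].
  rewrite <- Hts, <- Hns in h3, h4.
  unfold c, d; split; derive_tac; ring. }
exists (c a), (d a); split; [|split; [|split]]; trivial.
- transitivity ((p1 a ^ 2 + q1 a ^ 2) * (p2 a ^ 2 + q2 a ^ 2));
    [unfold c, d; ring | rewrite Hu, Hu2; ring].
- intros s.
  rewrite (derive_zero_const c (fun r => proj1 (Hc r)) a s).
  rewrite (derive_zero_const d (fun r => proj2 (Hc r)) a s).
  rewrite (frame_x _ _ _ _ _ _ H2 s), (frame_y _ _ _ _ _ _ H2 s).
  rewrite (frame_x _ _ _ _ _ _ H1 s), (frame_y _ _ _ _ _ _ H1 s).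
  destruct (Hs s) as [<- <-]; specialize (Hu s).
  generalize (tau x1 y1 p1 q1 s) (nu x1 y1 p1 q1 s); intros t n; unfold c, d.
  split.
  + transitivity ((t * p2 s - n * q2 s) * (p1 s ^ 2 + q1 s ^ 2));
      [rewrite Hu; ring | ring].
  + transitivity ((t * q2 s + n * p2 s) * (p1 s ^ 2 + q1 s ^ 2));
      [rewrite Hu; ring | ring].
Qed.

(** * Asymptotics of the arms *)

Lemma Cmod_pair (a b : R) : Cmod (a, b) = sqrt (a ^ 2 + b ^ 2).
Proof. reflexivity. Qed.

Lemma diverges_of_ratio (f : R -> R) (A : R) :
  A <> 0 -> (forall K, Rbar_locally p_infty (fun s => K < f s / A)) ->
  diverges f.
Proof.
intros HA H; destruct (Rdichotomy A 0 HA) as [h | h]; [right | left];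
  apply is_lim_spec; intros K.
- change (Rbar_locally p_infty (fun s => f s < K)).
  generalize (H (K / A)); apply filter_imp; intros s Hs.
  apply Rmult_lt_compat_r with (1 := Ropp_0_gt_lt_contravar _ h) in Hs.
  replace (K / A * - A) with (- K) in Hs by now field.
  replace (f s / A * - A) with (- f s) in Hs by now field.
  lra.
- change (Rbar_locally p_infty (fun s => K < f s)).
  generalize (H (K / A)); apply filter_imp; intros s Hs.
  apply Rmult_lt_compat_r with (r := A) in Hs; trivial.
  now field_simplify in Hs.
Qed.

Section Arm.

Variables (A B : R) (x y p q : R -> R).
Hypotheses (HA : A <> 0) (HB : 0 <= B) (H : frame A B x y p q).
Hypothesis H0 : tau x y p q 0 = 0.

Let Y : R -> C := fun s => (x s, y s).
Let t : R -> R := tau x y p q.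
Let n : R -> R := nu x y p q.

Let Hsys : support_system A B t n := frame_system A B x y p q H.

Lemma arm_Cmod (s : R) : Cmod (Y s) = sqrt (t s ^ 2 + n s ^ 2).
Proof.
unfold Y; rewrite Cmod_pair; f_equal; apply (frame_dist A B x y p q H).
Qed.

Lemma arm_tangential_pos (s : R) : 0 < s -> 0 < t s.
Proof. now apply (system_tangential_pos A B t n 0). Qed.

Lemma arm_distance : distance_increases_to_infinity Y.
Proof.
split.
- intros r1 r2 Hr; rewrite !arm_Cmod; apply sqrt_lt_1_alt; split.
  + pose proof (pow2_ge_0 (t r1)); pose proof (pow2_ge_0 (n r1)); lra.
  + apply (derive_pos_lt (fun s => t s ^ 2 + n s ^ 2) (fun s => 2 * t s)); [lra | |].
    * intros s _; now apply (system_derive_dist A B).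
    * intros s Hs; pose proof (arm_tangential_pos s); lra.
- apply is_lim_spec; intros K.
  change (Rbar_locally p_infty (fun s => K < Cmod (Y s))).
  generalize (dist_eventually A B t n HA HB Hsys (K ^ 2)); apply filter_imp.
  intros s Hs; rewrite arm_Cmod.
  apply Rle_lt_trans with (Rabs K); [apply Rle_abs|].
  rewrite <- (sqrt_pow2 (Rabs K)), pow2_abs by apply Rabs_pos.
  apply sqrt_lt_1_alt; split; trivial; apply pow2_ge_0.
Qed.

Lemma arm_curvature (s : R) : curvature Y s = A * t s + B * n s.
Proof. apply (frame_solution A B x y p q H). Qed.

Lemma arm_curvature_continuous (s : R) :
  continuous (fun s => A * t s + B * n s) s.
Proof.
destruct (Hsys s) as [h1 h2].
apply (@ex_derive_continuous R_AbsRing R_NormedModule).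
auto_derive; repeat split; trivial; eexists; eassumption.
Qed.

Lemma arm_total_curvature : infinite_total_curvature Y.
Proof.
destruct (frame_angle A B x y p q H) as [phi [Hphi _]].
apply (diverges_of_ratio _ A HA); intros K.
generalize (total_curvature_eventually A B t n HA HB Hsys phi
  (K + phi 0 / A) Hphi).
apply filter_imp; intros s Hs.
replace (RInt (curvature Y) 0 s) with (phi s - phi 0).
- unfold Rdiv in *; rewrite Rmult_minus_distr_r; lra.
- symmetry; apply is_RInt_unique.
  apply is_RInt_ext with (fun s => A * t s + B * n s).
  + intros r _; symmetry; apply arm_curvature.
  + apply (is_RInt_derive phi); intros r _; [apply Hphi|].
    apply arm_curvature_continuous.
Qed.

Lemma arm_spirals : spirals_infinitely Y.
Proof.
destruct (frame_angle A B x y p q H) as [phi [Hphi Hpq]].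
exists (polar t n phi); split.
- intros r Hr; pose proof (arm_tangential_pos r Hr) as Ht; split.
  + destruct (Hsys r) as [h1 h2]; specialize (Hphi r).
    apply (@ex_derive_continuous R_AbsRing R_NormedModule).
    unfold polar; auto_derive; repeat split; try (eexists; eassumption); lra.
  + pose proof (polar_cos t n phi r Ht) as Hc.
    pose proof (polar_sin t n phi r Ht) as Hs.
    rewrite arm_Cmod; set (m := sqrt (t r ^ 2 + n r ^ 2)) in *; clearbody m.
    unfold Y, expi, Cmult, RtoC; simpl fst; simpl snd.
    rewrite (frame_x A B x y p q H r), (frame_y A B x y p q H r).
    fold t n; destruct (Hpq r) as [-> ->].
    rewrite <- Hc, <- Hs; f_equal; ring.
- apply (diverges_of_ratio _ A HA); intros K.
  generalize (total_curvature_eventually A B t n HA HB Hsys phi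
    (* The 2 bounds the arctangent in [polar], whose absolute value is below PI / 2. *)
    (K + 2 / Rabs A) Hphi).
  apply filter_imp; intros s Hs; unfold polar.
  assert (Hat : Rabs (atan (n s / t s) / A) <= 2 / Rabs A).
  { unfold Rdiv; rewrite Rabs_mult, Rabs_inv.
    apply Rmult_le_compat_r.
    - now apply Rlt_le, Rinv_0_lt_compat, Rabs_pos_lt.
    - pose proof (atan_bound (n s * / t s)); pose proof PI_4.
      apply Rabs_le; lra. }
  apply Rabs_le_between in Hat; unfold Rdiv in *.
  rewrite Rmult_plus_distr_r; lra.
Qed.

Lemma arm_curvature_limit : is_lim (curvature Y) p_infty 0.
Proof.
apply is_lim_spec; intros eps.
change (Rbar_locally p_infty (fun s => Rabs (curvature Y s - 0) < eps)).
generalize (curvature_eventually A B t n HA HB Hsys eps (cond_pos eps)).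
apply filter_imp; intros s Hs; now rewrite arm_curvature, Rminus_0_r.
Qed.

Lemma arm_direction :
  growing_direction Y ((B + Ci * A) / sqrt (A ^ 2 + B ^ 2))%C.
Proof.
destruct (growing_direction_limits A B t n HA HB Hsys) as [H1 H2].
assert (HD : 0 < sqrt (A ^ 2 + B ^ 2)).
{ apply sqrt_lt_R0; pose proof (pow2_gt_0 A HA); pose proof (pow2_ge_0 B); lra. }
replace ((B + Ci * A) / sqrt (A ^ 2 + B ^ 2))%C
  with ((B / sqrt (A ^ 2 + B ^ 2), A / sqrt (A ^ 2 + B ^ 2)) : C).
2: { rewrite <- Cdiv_real by lra; f_equal.
     unfold Cplus, Cmult, Ci, RtoC; simpl; f_equal; ring. }
apply filterlim_locally; intros eps.
apply is_lim_spec in H1; apply is_lim_spec in H2.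
assert (H3 : Rbar_locally p_infty (fun s => 0 < s)) by now exists 0.
generalize (filter_and _ _ H3 (filter_and _ _ (H1 eps) (H2 eps))).
apply filter_imp; intros s [Hs [Hs1 Hs2]].
pose proof (arm_tangential_pos s Hs) as Ht.
replace (Cmod (Y s) * tangent Y s / Y s)%C with
  ((t s / sqrt (t s ^ 2 + n s ^ 2), - n s / sqrt (t s ^ 2 + n s ^ 2)) : C);
  [now split|].
assert (Hr : 0 < t s ^ 2 + n s ^ 2)
  by (pose proof (pow2_ge_0 (n s)); nra).
assert (Hsr := sqrt_lt_R0 _ Hr).
assert (Hss := sqrt_sqrt _ (Rlt_le _ _ Hr)).
rewrite arm_Cmod.
set (r := sqrt (t s ^ 2 + n s ^ 2)) in *.
destruct (proj2 (frame_solution A B x y p q H) s) as [Htan _].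
change (tangent Y s = (p s, q s)) in Htan; rewrite Htan.
assert (Hd := frame_dist A B x y p q H s); fold t n in Hd.
assert (Hxy : x s ^ 2 + y s ^ 2 = r * r) by lra.
unfold Y, Cdiv, Cinv, Cmult, RtoC; cbn [fst snd].
rewrite Hxy; f_equal; unfold t, n, tau, nu; field; lra.
Qed.

End Arm.

(** The open sets where g > r, for r > 0, cover [K]; the least r in a finite subcover works. It is
    the only way in which compactness in the plane enters. *)
Lemma compactC_positive_lower (K : C -> Prop) (g : C -> R) :
  compactC K -> (forall z, continuous g z) -> (forall z, K z -> 0 < g z) ->
  exists r, 0 < r /\ forall z, K z -> r < g z.
Proof.
intros HK Hg Hpos.
destruct (HK (fun U => exists r, 0 < r /\ U = (fun z => r < g z)))
  as [l [Hl Hcov]].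
- intros U [r [_ ->]].
  apply (open_comp g (fun v => r < v)); [intros; apply Hg | apply open_gt].
- intros z Hz; exists (fun z' => g z / 2 < g z'); specialize (Hpos z Hz).
  split; [exists (g z / 2); split; trivial; lra | lra].
- assert (Hr : exists r, 0 < r /\ forall U, In U l -> forall z, U z -> r < g z).
  { clear Hcov; induction l as [|U l IH].
    - exists 1; split; [lra | easy].
    - destruct IH as [r [Hr IH]]; [intros; apply Hl; now right|].
      destruct (Hl U) as [r' [Hr' HU]]; [now left|].
      exists (Rmin r r'); split; [now apply Rmin_glb_lt|].
      intros V [<- | HV] z Hz.
      + rewrite HU in Hz; pose proof (Rmin_r r r'); lra.
      + specialize (IH V HV z Hz); pose proof (Rmin_l r r'); lra. }
  destruct Hr as [r [Hr Hall]]; exists r; split; trivial.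
  intros z Hz; destruct (Hcov z Hz) as [U [HU HUz]]; now apply (Hall U).
Qed.

Lemma continuous_dist_sq (a b : R) (z : C) :
  continuous (fun z : C => (fst z - a) ^ 2 + (snd z - b) ^ 2) z.
Proof.
assert (Hsq : forall (h : C -> R) (c : R), continuous h z ->
          continuous (fun z => (h z - c) ^ 2) z).
{ intros h c Hh.
  apply (continuous_comp h (fun v => (v - c) ^ 2)); trivial.
  apply (@ex_derive_continuous R_AbsRing R_NormedModule).
  auto_derive; trivial. }
apply (continuous_plus (fun z : C => (fst z - a) ^ 2)
                       (fun z : C => (snd z - b) ^ 2)); apply Hsq.
- destruct z; apply continuous_fst.
- destruct z; apply continuous_snd.
Qed.

(** * Proper embeddedness of the whole curve *)

Section Curve.

Variables (A B : R) (x y p q : R -> R) (a : R).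
Hypotheses (HA : A <> 0) (HB : 0 <= B) (H : frame A B x y p q).
Hypothesis Ha : tau x y p q a = 0.

Let X : R -> C := fun s => (x s, y s).
Let f : R -> R := fun s => x s ^ 2 + y s ^ 2.
Let t : R -> R := tau x y p q.
Let n : R -> R := nu x y p q.

Lemma curve_dist_eq (s : R) : f s = t s ^ 2 + n s ^ 2.
Proof. apply (frame_dist A B x y p q H). Qed.

Lemma curve_dist_derive (s : R) : is_derive f s (2 * t s).
Proof.
apply is_derive_ext with (fun s => t s ^ 2 + n s ^ 2).
- intros r; symmetry; apply curve_dist_eq.
- apply (system_derive_dist A B), frame_system, H.
Qed.

Lemma curve_dist_incr (s1 s2 : R) : a <= s1 -> s1 < s2 -> f s1 < f s2.
Proof.
intros H1 H2; apply (derive_pos_lt f (fun s => 2 * t s)); trivial.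
- intros s _; apply curve_dist_derive.
- intros s Hs.
  assert (0 < t s); [|lra].
  apply (system_tangential_pos A B t n a HB); trivial; [|lra].
  now apply frame_system.
Qed.

Lemma curve_dist_decr (s1 s2 : R) : s1 < s2 -> s2 <= a -> f s2 < f s1.
Proof.
intros H1 H2; apply Ropp_lt_cancel.
apply (derive_pos_lt (fun s => - f s) (fun s => - (2 * t s))); trivial.
- intros s _; apply (is_derive_opp f), curve_dist_derive.
- intros s Hs.
  assert (t s < 0); [|lra].
  apply (system_tangential_neg A B t n a HB); trivial; [|lra].
  now apply frame_system.
Qed.

Lemma curve_dist_infinite (K : R) : exists S, forall s, S < Rabs s -> K < f s.
Proof.
assert (Hs := frame_system A B x y p q H).
destruct (dist_eventually A B t n HA HB Hs K) as [S1 HS1].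
destruct (dist_eventually A B _ _ HA HB (system_reverse A B 0 t n Hs) K)
  as [S2 HS2].
exists (Rmax S1 S2); intros s Hr; rewrite curve_dist_eq.
pose proof (Rmax_l S1 S2); pose proof (Rmax_r S1 S2).
destruct (Rcase_abs s) as [h | h].
- rewrite Rabs_left in Hr by trivial.
  specialize (HS2 (- s)); replace (0 - - s) with s in HS2 by ring; lra.
- rewrite Rabs_right in Hr by trivial; apply HS1; lra.
Qed.

Lemma curve_Cmod (s : R) : Cmod (X s) = sqrt (f s).
Proof. reflexivity. Qed.

Lemma curve_dist_nonneg (s : R) : 0 <= f s.
Proof.
unfold f; pose proof (pow2_ge_0 (x s)); pose proof (pow2_ge_0 (y s)); lra.
Qed.

Lemma curve_dist_min (s : R) : s <> a -> f a < f s.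
Proof.
intros Hs; destruct (Rdichotomy _ _ Hs) as [h | h].
- apply curve_dist_decr; lra.
- apply curve_dist_incr; lra.
Qed.

Lemma curve_closest : unique (closest X) a.
Proof.
split.
- intros s; rewrite !curve_Cmod; apply sqrt_le_1_alt.
  destruct (Req_dec s a) as [-> | h]; [lra|].
  now apply Rlt_le, curve_dist_min.
- intros b Hb; apply NNPP; intros h.
  specialize (Hb a); rewrite !curve_Cmod in Hb.
  assert (sqrt (f a) < sqrt (f b)); [|lra].
  apply sqrt_lt_1_alt; split; [apply curve_dist_nonneg|].
  apply curve_dist_min; intros ->; now apply h.
Qed.

(** The distance is injective on each arm, so only points of different arms have to be separated.
    The angle comparison needs [n] to differ at the start of the two arms, which fails exactly when
    the curve meets the origin. *)
Lemma curve_arms_disjoint (s1 s2 : R) :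
  s1 < a -> a < s2 -> f s1 = f s2 -> x s1 = x s2 -> y s1 = y s2 -> False.
Proof.
intros H1 H2 Hf Hx Hy.
destruct (Req_dec (n a) 0) as [Hn | Hn].
(* Reversed about [a], the curve has the same vanishing [tau] and [nu] at [a] and the opposite
   tangent, so it is the curve turned by PI: X(2 a - s) = -X(s). A crossing would be a point equal
   to its opposite, that is the origin, away from the closest point. *)
- assert (Hr := frame_reverse A B x y p q H (2 * a)).
  assert (Haa : 2 * a - a = a) by ring.
  destruct (frame_unique A B _ _ _ _ _ _ _ _ a H Hr)
    as [c [d [_ [Hc [Hd Hs]]]]].
  + rewrite Ha; unfold tau in *; rewrite Haa; lra.
  + unfold n, nu in *; rewrite Haa; lra.
  + rewrite Haa in Hc, Hd.
    destruct (H a) as [_ [_ [_ [_ Hu]]]].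
    assert (Hc1 : c = -1) by lra.
    assert (Hd0 : d = 0) by lra.
    destruct (Hs s1) as [Hxs Hys]; rewrite Hc1, Hd0 in Hxs, Hys.
    assert (Hfr : f (2 * a - s1) = f s1)
      by (unfold f; rewrite Hxs, Hys; ring).
    assert (Heq : 2 * a - s1 = s2).
    { destruct (Rtotal_order (2 * a - s1) s2) as [h | [h | h]]; trivial;
        apply curve_dist_incr in h; lra. }
    rewrite Heq in Hxs, Hys.
    assert (f s2 = 0).
    { unfold f; replace (x s2) with 0 by lra; replace (y s2) with 0 by lra.
      ring. }
    pose proof (curve_dist_incr a s2); pose proof (curve_dist_nonneg a); lra.
- destruct (frame_angle A B x y p q H) as [phi [Hphi Hpq]].
  assert (Hs := frame_system A B x y p q H); fold t n in Hs.
  set (t1 := fun s => t (a + s)); set (n1 := fun s => n (a + s)).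
  set (t2 := fun s => - t (a - s)); set (n2 := fun s => - n (a - s)).
  set (phi1 := fun s => phi (a + s)); set (phi2 := fun s => phi (a - s)).
  assert (Hs1 : support_system A B t1 n1) by now apply system_shift.
  assert (Hs2 : support_system A B t2 n2) by now apply system_reverse.
  assert (Hd : 0 < Rabs (polar t1 n1 phi1 (s2 - a) - polar t2 n2 phi2 (a - s1))
               < PI).
  { apply (arms_polar_difference A B); trivial; unfold t1, n1, t2, n2, phi1, phi2;
      rewrite ?Rplus_0_r, ?Rminus_0_r; fold t in Ha; try lra.
    - intros s; apply is_derive_shift, Hphi.
    - intros s.
      replace (A * - t (a - s) + B * - n (a - s))
        with (- (A * t (a - s) + B * n (a - s))) by ring.
      apply is_derive_reverse, Hphi.
    - replace (a + (s2 - a)) with s2 by ring.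
      replace (a - (a - s1)) with s1 by ring.
      rewrite <- !Rsqr_pow2, <- !Rsqr_neg, !Rsqr_pow2, <- !curve_dist_eq; lra. }
  assert (Ht1 : 0 < t1 (s2 - a))
    by (apply (system_tangential_pos A B t1 n1 0); trivial; [|lra];
        unfold t1; now rewrite Rplus_0_r).
  assert (Ht2 : 0 < t2 (a - s1))
    by (apply (system_tangential_pos A B t2 n2 0); trivial; [|lra];
        unfold t2; rewrite Rminus_0_r; fold t in Ha; lra).
  pose proof (polar_cos t1 n1 phi1 _ Ht1) as Hc1.
  pose proof (polar_sin t1 n1 phi1 _ Ht1) as Hi1.
  pose proof (polar_cos t2 n2 phi2 _ Ht2) as Hc2.
  pose proof (polar_sin t2 n2 phi2 _ Ht2) as Hi2.
  set (P1 := polar t1 n1 phi1 (s2 - a)) in *.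
  set (P2 := polar t2 n2 phi2 (a - s1)) in *.
  clearbody P1 P2; clear Hs1 Hs2.
  unfold t1, n1, t2, n2, phi1, phi2 in *.
  replace (a + (s2 - a)) with s2 in * by ring.
  replace (a - (a - s1)) with s1 in * by ring.
  replace ((- t s1) ^ 2 + (- n s1) ^ 2) with (f s1) in *
    by (rewrite curve_dist_eq; ring).
  rewrite <- curve_dist_eq, <- Hf in Hc1, Hi1.
  destruct (Hpq s1) as [Hp1 Hq1], (Hpq s2) as [Hp2 Hq2].
  rewrite <- Hp2, <- Hq2 in Hc1, Hi1; rewrite <- Hp1, <- Hq1 in Hc2, Hi2.
  pose proof (frame_x A B x y p q H s1) as E1.
  pose proof (frame_y A B x y p q H s1) as E2.
  pose proof (frame_x A B x y p q H s2) as E3.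
  pose proof (frame_y A B x y p q H s2) as E4.
  fold t n in E1, E2, E3, E4.
  assert (Hr : 0 < sqrt (f s1)).
  { apply sqrt_lt_R0; apply Rle_lt_trans with (1 := curve_dist_nonneg a).
    apply curve_dist_min; lra. }
  (* [P2] is a polar angle of -X at [s1], so a common point makes [P1] and [P2] differ by PI modulo
     2 PI, where the sine vanishes. *)
  assert (Hcos : cos P1 = - cos P2)
    by (apply Rmult_eq_reg_l with (sqrt (f s1)); lra).
  assert (Hsin : sin P1 = - sin P2)
    by (apply Rmult_eq_reg_l with (sqrt (f s1)); lra).
  pose proof (sin_gt_0 _ (proj1 Hd) (proj2 Hd)) as Hpos.
  assert (Hz : sin (P1 - P2) = 0) by (rewrite sin_minus, Hcos, Hsin; ring).
  unfold Rabs in Hpos; destruct (Rcase_abs (P1 - P2)) in Hpos;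
    rewrite ?sin_neg in Hpos; lra.
Qed.

Lemma curve_injective (s1 s2 : R) : X s1 = X s2 -> s1 = s2.
Proof.
intros Heq.
assert (Hx : x s1 = x s2) by exact (f_equal fst Heq).
assert (Hy : y s1 = y s2) by exact (f_equal snd Heq).
assert (Hf : f s1 = f s2) by (unfold f; now rewrite Hx, Hy).
assert (Hlt : forall u v, f u = f v -> x u = x v -> y u = y v -> ~ u < v).
{ intros u v Huv Hxuv Hyuv h.
  destruct (Rle_dec v a) as [h1 | h1]; [apply curve_dist_decr in h; lra|].
  destruct (Rle_dec a u) as [h2 | h2]; [apply curve_dist_incr in h; lra|].
  apply (curve_arms_disjoint u v); trivial; lra. }
destruct (Rtotal_order s1 s2) as [h | [h | h]]; trivial; exfalso;
  now apply Hlt in h.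
Qed.

(** Outside the window of radius [eps] the distance to X(s) is bounded below: by injectivity and
    compactness on a bounded range of parameters, by the growth of |X| beyond it. *)
Lemma curve_homeomorphic (s eps : R) : 0 < eps ->
  exists delta, 0 < delta /\
    forall s', Cmod (X s' - X s)%C < delta -> Rabs (s' - s) < eps.
Proof.
intros He.
set (g := fun r => (x r - x s) ^ 2 + (y r - y s) ^ 2).
assert (Hg : forall r, Cmod (X r - X s)%C = sqrt (g r)) by reflexivity.
assert (Hgpos : forall r, r <> s -> 0 < g r).
{ intros r Hr; unfold g.
  pose proof (pow2_ge_0 (x r - x s)); pose proof (pow2_ge_0 (y r - y s)).
  apply Rnot_le_lt; intros h; apply Hr, curve_injective.
  assert (x r - x s = 0) by (apply Rsqr_0_uniq; unfold Rsqr; lra).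
  assert (y r - y s = 0) by (apply Rsqr_0_uniq; unfold Rsqr; lra).
  unfold X; f_equal; lra. }
assert (Hgc : forall r, continuity_pt g r).
{ intros r; destruct (H r) as [h1 [h2 _]].
  eapply is_derive_continuity_pt; unfold g; derive_tac; reflexivity. }
(* From |X(r)|^2 <= 2 |X(r) - X(s)|^2 + 2 |X(s)|^2, a value of f above [2 * f s + 2] gives a squared
   distance to X(s) above 1. *)
destruct (curve_dist_infinite (2 * f s + 2)) as [S HS].
set (S' := Rmax (Rabs S) (Rabs s + eps)).
assert (HS' : Rabs S <= S' /\ Rabs s + eps <= S')
  by (split; [apply Rmax_l | apply Rmax_r]).
pose proof (Rle_abs S); pose proof (Rle_abs s); pose proof (Rle_abs (- s)) as Hsn.
rewrite Rabs_Ropp in Hsn.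
destruct (continuity_ab_min g (- S') (s - eps)) as [m1 [Hm1 Hm1']];
  [lra | now intros |].
destruct (continuity_ab_min g (s + eps) S') as [m2 [Hm2 Hm2']];
  [lra | now intros |].
set (d := Rmin 1 (Rmin (g m1) (g m2))).
assert (Hd1 : d <= 1) by apply Rmin_l.
assert (Hd2 : d <= g m1)
  by (eapply Rle_trans; [apply Rmin_r | apply Rmin_l]).
assert (Hd3 : d <= g m2)
  by (eapply Rle_trans; [apply Rmin_r | apply Rmin_r]).
assert (Hd : 0 < d) by (repeat apply Rmin_glb_lt; try apply Hgpos; lra).
exists (sqrt d); split; [now apply sqrt_lt_R0|].
intros r Hr; rewrite Hg in Hr; apply sqrt_lt_0_alt in Hr.
apply Rnot_le_lt; intros h.
destruct (Rlt_dec S' (Rabs r)) as [hS | hS].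
- assert (Hfr : 2 * f s + 2 < f r) by (apply HS; lra).
  unfold f, g in *; clear - Hfr Hr Hd1.
  pose proof (pow2_ge_0 (x r - 2 * x s)); pose proof (pow2_ge_0 (y r - 2 * y s)).
  nra.
- apply Rnot_lt_le, Rabs_le_between in hS.
  unfold Rabs in h; destruct (Rcase_abs (r - s)) in h.
  + specialize (Hm1 r); lra.
  + specialize (Hm2 r); lra.
Qed.

Lemma curve_proper : proper X.
Proof.
intros K HK.
(* A positive lower bound for exp(-|z|^2) on [K] is an upper bound for |z|, so the preimage lies in
   some [-S, S]. *)
destruct (compactC_positive_lower K
  (fun z => exp (- ((fst z - 0) ^ 2 + (snd z - 0) ^ 2)))) as [r [Hr Hb]]; trivial.
{ intros z.
  apply (continuous_comp (fun z : C => (fst z - 0) ^ 2 + (snd z - 0) ^ 2)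
                         (fun v => exp (- v))).
  - apply continuous_dist_sq.
  - apply (@ex_derive_continuous R_AbsRing R_NormedModule).
    auto_derive; trivial. }
{ intros; apply exp_pos. }
destruct (curve_dist_infinite (- ln r)) as [S HS].
apply (compact_P4 (fun c => - S <= c <= S)); [apply compact_P3 | |].
- intros s0 Hs0.
  (* The preimage is closed: a point off [K] has positive distance to [K], and nearby parameters
     keep within that distance. *)
  destruct (compactC_positive_lower K
    (fun z => (fst z - x s0) ^ 2 + (snd z - y s0) ^ 2)) as [e [He Hpos]]; trivial.
  { intros; apply continuous_dist_sq. }
  { intros z Hz.
    pose proof (pow2_ge_0 (fst z - x s0)); pose proof (pow2_ge_0 (snd z - y s0)).
    apply Rnot_le_lt; intros h; apply Hs0.
    replace (X s0) with z; trivial.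
    assert (fst z - x s0 = 0) by (apply Rsqr_0_uniq; unfold Rsqr; lra).
    assert (snd z - y s0 = 0) by (apply Rsqr_0_uniq; unfold Rsqr; lra).
    rewrite (surjective_pairing z); unfold X; f_equal; lra. }
  set (g := fun s => (x s - x s0) ^ 2 + (y s - y s0) ^ 2).
  assert (Hg : continuity_pt g s0).
  { destruct (H s0) as [h1 [h2 _]].
    eapply is_derive_continuity_pt; unfold g; derive_tac; reflexivity. }
  destruct (Hg e He) as [d [Hd Hgd]].
  exists (mkposreal d Hd); intros s Hs Hks.
  specialize (Hpos _ Hks); change (e < g s) in Hpos.
  destruct (Req_dec s0 s) as [<- | h].
  + unfold g in Hpos; simpl in Hpos; lra.
  + specialize (Hgd s); simpl in Hgd; unfold R_dist in Hgd.
    unfold disc in Hs; simpl in Hs.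
    replace (g s0) with 0 in Hgd by (unfold g; ring).
    rewrite Rminus_0_r in Hgd.
    pose proof (Rle_abs (g s)).
    assert (Rabs (g s) < e); [|lra].
    apply Hgd; split; [split; [exact I | exact h] | exact Hs].
- intros s Hs; specialize (Hb _ Hs).
  change (r < exp (- ((x s - 0) ^ 2 + (y s - 0) ^ 2))) in Hb.
  rewrite !Rminus_0_r in Hb.
  apply ln_increasing in Hb; trivial; rewrite ln_exp in Hb.
  change (x s ^ 2 + y s ^ 2) with (f s) in Hb.
  apply Rabs_le_between, Rnot_lt_le; intros h.
  specialize (HS s h); lra.
Qed.

Lemma curve_properly_embedded : properly_embedded X.
Proof.
destruct (frame_solution A B x y p q H) as [[Hsm [Hu _]] _].
split; [split; [|split] | apply curve_proper].
- split; [exact Hsm|]; intros s Hs.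
  specialize (Hu s); change (Cmod (deriveC X s) = 1) in Hu.
  rewrite Hs, Cmod_0 in Hu; lra.
- apply curve_injective.
- apply curve_homeomorphic.
Qed.

End Curve.

(** * Existence *)

Lemma Rle_of_le_geometric (a C : R) : (forall n, a <= C / 2 ^ n) -> a <= 0.
Proof.
intros H; apply Rnot_lt_le; intros h.
destruct (Rle_dec C 0) as [hC | hC].
- specialize (H 0%nat); simpl in H; lra.
- destruct (pow_lt_1_zero (/ 2)) with (y := a / C) as [N HN].
  + rewrite Rabs_pos_eq; lra.
  + apply Rdiv_lt_0_compat; lra.
  + specialize (HN N (le_n N)); specialize (H N).
    rewrite Rabs_pos_eq in HN by (apply pow_le; lra).
    rewrite pow_inv in HN.
    apply Rmult_lt_compat_l with (r := C) in HN; [|lra].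
    replace (C * (a / C)) with a in HN by (field; lra).
    unfold Rdiv in H; lra.
Qed.

Lemma exp_nondecreasing (a b : R) : a <= b -> exp a <= exp b.
Proof. intros [h | ->]; [now apply Rlt_le, exp_increasing | apply Rle_refl]. Qed.

(** The tail C / 2^n + C / 2^(n+1) + ... sums to 2 C / 2^n, so the intervals of that radius around
    [u n] are nested and the supremum of their left ends lies in all of them. *)
Lemma geometric_limit (u : nat -> R) (C : R) :
  (forall n, Rabs (u (S n) - u n) <= C / 2 ^ n) ->
  exists l, forall n, Rabs (l - u n) <= 2 * C / 2 ^ n.
Proof.
intros Hu.
set (v := fun n => u n + 2 * C / 2 ^ n); set (w := fun n => u n - 2 * C / 2 ^ n).
assert (Hhalf : forall n, 2 * C / 2 ^ (S n) = C / 2 ^ n).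
{ intros n; simpl; field; apply pow_nonzero; lra. }
assert (Htwo : forall n, 2 * C / 2 ^ n = C / 2 ^ n + C / 2 ^ n).
{ intros n; field; apply pow_nonzero; lra. }
assert (Hv : forall n m, (n <= m)%nat -> v m <= v n /\ w n <= w m).
{ intros n m Hnm; induction Hnm as [|m _ [IH1 IH2]]; [lra|].
  specialize (Hu m); apply Rabs_le_between in Hu.
  unfold v, w in *; rewrite Hhalf, (Htwo m) in *; lra. }
assert (Hwv : forall n, w n <= v n).
{ intros n; unfold w, v; specialize (Hu n).
  pose proof (Rabs_pos (u (S n) - u n)); rewrite Htwo; lra. }
assert (Hall : forall n m, w n <= v m).
{ intros n m; destruct (Nat.le_ge_cases n m) as [h | h];
    destruct (Hv _ _ h); pose proof (Hwv n); pose proof (Hwv m); lra. }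
destruct (completeness (fun r => exists n, r = w n)) as [l [Hl1 Hl2]].
- exists (v 0%nat); intros r [n ->]; apply Hall.
- now exists (w 0%nat), 0%nat.
- exists l; intros n.
  assert (w n <= l) by (apply Hl1; now exists n).
  assert (l <= v n) by (apply Hl2; intros r [m ->]; apply Hall).
  unfold v, w in *; apply Rabs_le; lra.
Qed.

(** In the sup norm weighted by exp(-L |s|), integration gains a factor 1 / L. A large L thus makes
    the Picard step contract on all of [-S, S], without shortening the interval. *)
Lemma exp_weighted_bound (F f : R -> R) (K L S : R) :
  0 < L -> F 0 = 0 -> 0 <= K -> (forall s, is_derive F s (f s)) ->
  (forall s, Rabs s <= S -> Rabs (f s) <= K * exp (L * Rabs s)) ->
  forall s, Rabs s <= S -> Rabs (F s) <= K / L * exp (L * Rabs s).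
Proof.
intros HL HF0 HK HF Hf.
assert (Hpos : forall (G g : R -> R) s, 0 <= s -> s <= S -> G 0 = 0 ->
   (forall r, is_derive G r (g r)) ->
   (forall r, 0 <= r -> r <= S -> g r <= K * exp (L * r)) ->
   G s <= K / L * exp (L * s)).
{ intros G g s Hs HsS HG0 HG Hg.
  assert (H : 0 * (s - 0) <=
     (K / L * exp (L * s) - G s) - (K / L * exp (L * 0) - G 0)).
  { apply (derive_le_lower (fun r => K / L * exp (L * r) - G r)
      (fun r => K * exp (L * r) - g r)); trivial.
    - intros r _; specialize (HG r); derive_tac; field; lra.
    - intros r Hr; specialize (Hg r); lra. }
  rewrite HG0, Rmult_0_r, exp_0 in H.
  assert (0 <= K / L) by (apply Rdiv_le_0_compat; lra); lra. }
assert (Hall : forall (G g : R -> R) s, 0 <= s -> s <= S -> G 0 = 0 ->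
   (forall r, is_derive G r (g r)) ->
   (forall r, 0 <= r -> r <= S -> Rabs (g r) <= K * exp (L * r)) ->
   Rabs (G s) <= K / L * exp (L * s)).
{ intros G g s Hs HsS HG0 HG Hg; apply Rabs_le; split.
  - assert (- G s <= K / L * exp (L * s)); [|lra].
    apply (Hpos (fun r => - G r) (fun r => - g r)); trivial; [lra | |].
    + intros r; apply (is_derive_opp G), HG.
    + intros r Hr HrS; specialize (Hg r Hr HrS).
      apply Rabs_le_between in Hg; lra.
  - apply (Hpos G g); trivial; intros r Hr HrS; specialize (Hg r Hr HrS).
    apply Rabs_le_between in Hg; lra. }
intros s Hs; unfold Rabs at 2; unfold Rabs in Hs.
destruct (Rcase_abs s) as [h | h].
- replace (F s) with (F (0 - - s)) by (f_equal; ring).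
  apply (Hall (fun r => F (0 - r)) (fun r => - f (0 - r))); try lra.
  + rewrite Rminus_0_r; exact HF0.
  + intros r; apply is_derive_reverse, HF.
  + intros r Hr HrS; rewrite Rabs_Ropp.
    replace (L * r) with (L * Rabs (0 - r))
      by (rewrite Rminus_0_l, Rabs_Ropp, Rabs_pos_eq; trivial).
    apply Hf; rewrite Rminus_0_l, Rabs_Ropp, Rabs_pos_eq; trivial.
- apply (Hall F f); trivial; try lra.
  intros r Hr HrS; rewrite <- (Rabs_pos_eq r) at 2 by trivial.
  apply Hf; now rewrite Rabs_pos_eq.
Qed.

Lemma cos_lipschitz (a b : R) : Rabs (cos a - cos b) <= Rabs (a - b).
Proof.
assert (H : forall u v, u < v -> Rabs (cos v - cos u) <= Rabs (v - u)).
{ intros u v Huv; destruct (mvt cos (fun r => - sin r) u v Huv) as [c [-> _]].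
  - intros r _; apply is_derive_cos.
  - rewrite Rabs_mult, Rabs_Ropp; rewrite <- (Rmult_1_l (Rabs (v - u))) at 2.
    apply Rmult_le_compat_r; [apply Rabs_pos|].
    pose proof (SIN_bound c); apply Rabs_le; lra. }
destruct (Rtotal_order a b) as [h | [-> | h]].
- rewrite Rabs_minus_sym, (Rabs_minus_sym a); now apply H.
- rewrite !Rminus_diag; lra.
- now apply H.
Qed.

Lemma sin_lipschitz (a b : R) : Rabs (sin a - sin b) <= Rabs (a - b).
Proof.
rewrite !sin_cos.
replace (- cos (PI / 2 + a) - - cos (PI / 2 + b))
  with (- (cos (PI / 2 + a) - cos (PI / 2 + b))) by ring.
rewrite Rabs_Ropp; eapply Rle_trans; [apply cos_lipschitz|].
apply Req_le; f_equal; ring.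
Qed.

Section Picard.

Variables A B d : R.

(** The curve with tangent angle [phi] starting at (0, d). With [phi 0 = 0] it has [tau = 0] and
    [nu = d] at the start, which is therefore its closest point. *)
Let xf (phi : R -> R) (s : R) : R := RInt (fun r => cos (phi r)) 0 s.
Let yf (phi : R -> R) (s : R) : R := d + RInt (fun r => sin (phi r)) 0 s.
Let kf (phi : R -> R) (s : R) : R :=
  A * (xf phi s * cos (phi s) + yf phi s * sin (phi s))
  + B * (yf phi s * cos (phi s) - xf phi s * sin (phi s)).
Let step (phi : R -> R) (s : R) : R := RInt (kf phi) 0 s.

Let cont (phi : R -> R) : Prop := forall s, continuous phi s.

Lemma derive_xf (phi : R -> R) (s : R) :
  cont phi -> is_derive (xf phi) s (cos (phi s)).
Proof.
intros H; apply (is_derive_primitive (fun r => cos (phi r))).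
intros r; apply (continuous_comp phi cos); [apply H | apply continuous_cos].
Qed.

Lemma derive_yf (phi : R -> R) (s : R) :
  cont phi -> is_derive (yf phi) s (sin (phi s)).
Proof.
intros H; replace (sin (phi s)) with (0 + sin (phi s)) by ring.
apply (is_derive_plus (fun _ => d) (RInt (fun r => sin (phi r)) 0)).
- apply (is_derive_const d).
- apply (is_derive_primitive (fun r => sin (phi r))).
  intros r; apply (continuous_comp phi sin); [apply H | apply continuous_sin].
Qed.

Lemma continuous_kf (phi : R -> R) : cont phi -> cont (kf phi).
Proof.
intros H s.
assert (Hx : continuous (xf phi) s)
  by (eapply is_derive_continuous, derive_xf, H).
assert (Hy : continuous (yf phi) s)
  by (eapply is_derive_continuous, derive_yf, H).
assert (Hc : continuous (fun r => cos (phi r)) s)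
  by (apply (continuous_comp phi cos); [apply H | apply continuous_cos]).
assert (Hs : continuous (fun r => sin (phi r)) s)
  by (apply (continuous_comp phi sin); [apply H | apply continuous_sin]).
unfold kf.
apply (continuous_plus
  (fun s => A * (xf phi s * cos (phi s) + yf phi s * sin (phi s)))
  (fun s => B * (yf phi s * cos (phi s) - xf phi s * sin (phi s)))).
- apply (continuous_scal_r A
    (fun s => xf phi s * cos (phi s) + yf phi s * sin (phi s))).
  apply (continuous_plus (fun s => xf phi s * cos (phi s))
    (fun s => yf phi s * sin (phi s))); now apply (continuous_mult (K := R_AbsRing)).
- apply (continuous_scal_r B
    (fun s => yf phi s * cos (phi s) - xf phi s * sin (phi s))).
  apply (continuous_minus (fun s => yf phi s * cos (phi s))
    (fun s => xf phi s * sin (phi s))); now apply (continuous_mult (K := R_AbsRing)).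
Qed.

Lemma derive_step (phi : R -> R) (s : R) :
  cont phi -> is_derive (step phi) s (kf phi s).
Proof. intros H; apply is_derive_primitive; now apply continuous_kf. Qed.

Lemma continuous_step (phi : R -> R) : cont phi -> cont (step phi).
Proof. intros H s; eapply is_derive_continuous, derive_step, H. Qed.

Lemma unit_primitive_bound (F f : R -> R) :
  F 0 = 0 -> (forall s, is_derive F s (f s)) -> (forall s, Rabs (f s) <= 1) ->
  forall s, Rabs (F s) <= Rabs s.
Proof.
intros H0 HF Hf s.
destruct (MVT_gen F 0 s f) as [c [_ Hc]].
- intros; apply HF.
- intros r _; eapply is_derive_continuity_pt, HF.
- rewrite H0, !Rminus_0_r in Hc; rewrite Hc, Rabs_mult.
  specialize (Hf c); pose proof (Rabs_pos s); nra.
Qed.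

Lemma RInt_point_R (f : R -> R) : RInt f 0 0 = 0.
Proof. now rewrite RInt_point. Qed.

(** The sum (1 + S) + (1 + |d| + S) of the Lipschitz factors of the products of x and of y with a
    cosine or sine, on [-S, S]. *)
Let C0 (S : R) : R := 2 + 2 * S + Rabs d.
(** At least twice the Lipschitz constant of [kf], so that the step contracts by 1/2. The added 1
    keeps it above 1, so that the errors of x and y are no larger than the weighted error of the
    angle. *)
Let L (S : R) : R := 2 * (Rabs A + Rabs B + 1) * C0 S.

Lemma step_contracts (phi psi : R -> R) (K S : R) :
  cont phi -> cont psi -> 0 <= K -> 0 <= S ->
  (forall s, Rabs s <= S -> Rabs (phi s - psi s) <= K * exp (L S * Rabs s)) ->
  forall s, Rabs s <= S ->
    Rabs (step phi s - step psi s) <= K / 2 * exp (L S * Rabs s).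
Proof.
intros Hphi Hpsi HK HS Hd s Hs.
assert (HAB : 0 <= Rabs A + Rabs B)
  by (pose proof (Rabs_pos A); pose proof (Rabs_pos B); lra).
assert (HC : 2 <= C0 S) by (unfold C0; pose proof (Rabs_pos d); lra).
assert (HL : 1 <= L S) by (unfold L; nra).
assert (Hx : forall r, Rabs r <= S ->
   Rabs (xf phi r - xf psi r) <= K / L S * exp (L S * Rabs r)).
{ apply (exp_weighted_bound (fun r => xf phi r - xf psi r)
    (fun r => cos (phi r) - cos (psi r))); trivial; [lra | | |].
  - unfold xf; rewrite !RInt_point_R; ring.
  - intros r; apply (is_derive_minus (xf phi) (xf psi)); now apply derive_xf.
  - intros r Hr; eapply Rle_trans; [apply cos_lipschitz | now apply Hd]. }
assert (Hy : forall r, Rabs r <= S ->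
   Rabs (yf phi r - yf psi r) <= K / L S * exp (L S * Rabs r)).
{ apply (exp_weighted_bound (fun r => yf phi r - yf psi r)
    (fun r => sin (phi r) - sin (psi r))); trivial; [lra | | |].
  - unfold yf; rewrite !RInt_point_R; ring.
  - intros r; apply (is_derive_minus (yf phi) (yf psi)); now apply derive_yf.
  - intros r Hr; eapply Rle_trans; [apply sin_lipschitz | now apply Hd]. }
assert (Hxb : forall r, Rabs (xf psi r) <= Rabs r).
{ apply unit_primitive_bound with (fun r => cos (psi r)).
  - apply RInt_point_R.
  - intros r; now apply derive_xf.
  - intros r; pose proof (COS_bound (psi r)); apply Rabs_le; lra. }
assert (Hyb : forall r, Rabs (yf psi r) <= Rabs d + Rabs r).
{ intros r; unfold yf; eapply Rle_trans; [apply Rabs_triang|].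
  apply Rplus_le_compat_l; revert r.
  apply unit_primitive_bound with (fun r => sin (psi r)).
  - apply RInt_point_R.
  - intros r; apply (is_derive_primitive (fun r => sin (psi r))).
    intros v; apply (continuous_comp psi sin); [apply Hpsi | apply continuous_sin].
  - intros r; pose proof (SIN_bound (psi r)); apply Rabs_le; lra. }
replace (K / 2) with ((L S * K / 2) / L S) by (field; lra).
apply (exp_weighted_bound (fun r => step phi r - step psi r)
  (fun r => kf phi r - kf psi r) _ _ S); trivial; [lra | | | |].
- unfold step; rewrite !RInt_point_R; ring.
- assert (0 <= L S * K) by (apply Rmult_le_pos; lra); lra.
- intros r; apply (is_derive_minus (step phi) (step psi)); now apply derive_step.
- intros r Hr.
  specialize (Hx r Hr); specialize (Hy r Hr); specialize (Hxb r).
  specialize (Hyb r); specialize (Hd r Hr).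
  assert (HKL : K / L S <= K).
  { apply Rmult_le_reg_r with (L S); [lra|].
    replace (K / L S * L S) with K by (field; lra); nra. }
  set (e := K * exp (L S * Rabs r)) in *.
  assert (He : 0 <= e)
    by (apply Rmult_le_pos; [trivial | apply Rlt_le, exp_pos]).
  assert (Hx' : Rabs (xf phi r - xf psi r) <= e).
  { eapply Rle_trans; [apply Hx|]; apply Rmult_le_compat_r; trivial.
    apply Rlt_le, exp_pos. }
  assert (Hy' : Rabs (yf phi r - yf psi r) <= e).
  { eapply Rle_trans; [apply Hy|]; apply Rmult_le_compat_r; trivial.
    apply Rlt_le, exp_pos. }
  pose proof (cos_lipschitz (phi r) (psi r)) as Hc.
  pose proof (sin_lipschitz (phi r) (psi r)) as Hsn.
  assert (Hprod : forall u1 u2 c1 c2 m, Rabs (u1 - u2) <= e -> Rabs u2 <= m ->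
     Rabs c1 <= 1 -> Rabs (c1 - c2) <= e -> Rabs (u1 * c1 - u2 * c2) <= e + m * e).
  { intros u1 u2 c1 c2 m h1 h2 h3 h4.
    replace (u1 * c1 - u2 * c2) with ((u1 - u2) * c1 + u2 * (c1 - c2)) by ring.
    eapply Rle_trans; [apply Rabs_triang|]; rewrite !Rabs_mult.
    pose proof (Rabs_pos (u1 - u2)); pose proof (Rabs_pos u2).
    pose proof (Rabs_pos c1); pose proof (Rabs_pos (c1 - c2)).
    apply Rplus_le_compat.
    - rewrite <- (Rmult_1_r e); now apply Rmult_le_compat.
    - now apply Rmult_le_compat. }
  assert (hc : Rabs (cos (phi r)) <= 1)
    by (pose proof (COS_bound (phi r)); apply Rabs_le; lra).
  assert (hs : Rabs (sin (phi r)) <= 1)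
    by (pose proof (SIN_bound (phi r)); apply Rabs_le; lra).
  assert (hxS : Rabs (xf psi r) <= S) by lra.
  assert (hyS : Rabs (yf psi r) <= Rabs d + S) by lra.
  assert (Hxc := Hprod _ _ (cos (phi r)) (cos (psi r)) _ Hx' hxS hc
                  (Rle_trans _ _ _ Hc Hd)).
  assert (Hxs := Hprod _ _ (sin (phi r)) (sin (psi r)) _ Hx' hxS hs
                  (Rle_trans _ _ _ Hsn Hd)).
  assert (Hyc := Hprod _ _ (cos (phi r)) (cos (psi r)) _ Hy' hyS hc
                  (Rle_trans _ _ _ Hc Hd)).
  assert (Hys := Hprod _ _ (sin (phi r)) (sin (psi r)) _ Hy' hyS hs
                  (Rle_trans _ _ _ Hsn Hd)).
  assert (HCe : (e + S * e) + (e + (Rabs d + S) * e) = C0 S * e)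
    by (unfold C0; ring).
  replace (kf phi r - kf psi r) with
    (A * ((xf phi r * cos (phi r) - xf psi r * cos (psi r))
          + (yf phi r * sin (phi r) - yf psi r * sin (psi r)))
     + B * ((yf phi r * cos (phi r) - yf psi r * cos (psi r))
            - (xf phi r * sin (phi r) - xf psi r * sin (psi r))))
    by (unfold kf; ring).
  eapply Rle_trans; [apply Rabs_triang|]; rewrite !Rabs_mult.
  apply Rle_trans with (Rabs A * (C0 S * e) + Rabs B * (C0 S * e)).
  + apply Rplus_le_compat; (apply Rmult_le_compat_l; [apply Rabs_pos|]).
    * eapply Rle_trans; [apply Rabs_triang | lra].
    * unfold Rminus at 1; eapply Rle_trans; [apply Rabs_triang|].
      rewrite Rabs_Ropp; lra.
  + replace (L S * K / 2 * exp (L S * Rabs r)) with (L S / 2 * e)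
      by (unfold e; field).
    unfold L; assert (0 <= C0 S * e) by (apply Rmult_le_pos; lra); lra.
Qed.

Let it (m : nat) : R -> R := Nat.iter m step (fun _ => 0).

Lemma continuous_it (m : nat) : cont (it m).
Proof.
induction m as [|m IH]; [intros s; apply continuous_const|].
change (cont (step (it m))); exact (continuous_step (it m) IH).
Qed.

Lemma it_bound (S : R) : 0 <= S -> exists K, 0 <= K /\
  forall m s, Rabs s <= S ->
    Rabs (it (Datatypes.S m) s - it m s) <= K * exp (L S * Rabs s) / 2 ^ m.
Proof.
intros HS.
destruct (continuous_bounded (it 1) (- S) S) as [K HK];
  [lra | apply (continuous_it 1) |].
assert (HK0 : 0 <= K).
{ eapply Rle_trans; [apply Rabs_pos | apply (HK 0); lra]. }
assert (HLS : 0 <= L S).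
{ unfold L, C0; pose proof (Rabs_pos A); pose proof (Rabs_pos B).
  pose proof (Rabs_pos d); apply Rmult_le_pos; lra. }
exists K; split; trivial.
assert (Hm : forall m s, Rabs s <= S ->
    Rabs (it (Datatypes.S m) s - it m s) <= K / 2 ^ m * exp (L S * Rabs s)).
{ induction m as [|m IH]; intros s Hs.
  - replace (it 1 s - it 0 s) with (it 1 s) by (unfold it at 2; simpl; ring).
    eapply Rle_trans; [apply HK; now apply Rabs_le_between|].
    simpl; rewrite Rdiv_1_r; rewrite <- (Rmult_1_r K) at 1.
    apply Rmult_le_compat_l; trivial.
    rewrite <- exp_0; apply exp_nondecreasing, Rmult_le_pos; trivial; apply Rabs_pos.
  - replace (K / 2 ^ Datatypes.S m) with (K / 2 ^ m / 2)
      by (simpl; field; apply pow_nonzero; lra).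
    apply (step_contracts (it (Datatypes.S m)) (it m)); trivial;
      try apply continuous_it.
    apply Rdiv_le_0_compat; trivial; apply pow_lt; lra. }
intros m s Hs; unfold Rdiv; rewrite Rmult_assoc, (Rmult_comm (exp _)).
rewrite <- Rmult_assoc; now apply Hm.
Qed.

Lemma it_limit : exists phi, forall S, 0 <= S -> exists K, 0 <= K /\
  forall m s, Rabs s <= S ->
    Rabs (phi s - it m s) <= K / 2 ^ m * exp (L S * Rabs s).
Proof.
assert (Hlim : forall s, exists l, exists C, forall m,
   Rabs (l - it m s) <= C / 2 ^ m).
{ intros s; destruct (it_bound (Rabs s) (Rabs_pos s)) as [K [_ HK]].
  destruct (geometric_limit (fun m => it m s)
    (K * exp (L (Rabs s) * Rabs s))) as [l Hl].
  - intros m; apply HK; lra.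
  - now exists l, (2 * (K * exp (L (Rabs s) * Rabs s))). }
exists (fun s => proj1_sig (constructive_indefinite_description _ (Hlim s))).
intros S HS; destruct (it_bound S HS) as [K [HK0 HK]].
exists (2 * K); split; [lra|]; intros m s Hs.
destruct (constructive_indefinite_description _ (Hlim s)) as [l [C HC]]; simpl.
(* The limit was chosen pointwise, with a constant depending on [s]. The limit obtained with the
   bound for [-S, S] is the same number, so the chosen one inherits the uniform rate. *)
destruct (geometric_limit (fun m => it m s) (K * exp (L S * Rabs s)))
  as [l' Hl']; [intros; now apply HK|].
assert (Hle : Rabs (l - l') <= 0).
{ apply (Rle_of_le_geometric _ (C + 2 * (K * exp (L S * Rabs s)))).
  intros j; replace (l - l') with ((l - it j s) + - (l' - it j s)) by ring.
  eapply Rle_trans; [apply Rabs_triang|]; rewrite Rabs_Ropp.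
  specialize (HC j); specialize (Hl' j); cbv beta in Hl'.
  unfold Rdiv in *; lra. }
assert (l = l') as ->.
{ apply Rminus_diag_uniq, NNPP; intros h; apply Rabs_pos_lt in h; lra. }
eapply Rle_trans; [apply Hl'|]; unfold Rdiv; lra.
Qed.

(** The limit is locally uniform, hence continuous, so the contraction estimate applies to it and
    shows that it is fixed by [step]. *)
Lemma picard_solution : exists phi, cont phi /\ phi 0 = 0 /\
  forall s, is_derive phi s (kf phi s).
Proof.
destruct it_limit as [phi Hphi].
assert (Hc : cont phi).
{ intros s; apply continuity_pt_filterlim; intros eps Heps.
  set (S := Rabs s + 1).
  assert (HS : 0 <= S) by (unfold S; pose proof (Rabs_pos s); lra).
  destruct (Hphi S HS) as [K [HK0 HK]].
  set (E := K * exp (L S * S)).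
  assert (HLS : 0 <= L S).
  { unfold L, C0; pose proof (Rabs_pos A); pose proof (Rabs_pos B).
    pose proof (Rabs_pos d); apply Rmult_le_pos; lra. }
  assert (HE : forall m r, Rabs r <= S -> Rabs (phi r - it m r) <= E / 2 ^ m).
  { intros m r Hr; eapply Rle_trans; [now apply HK|].
    unfold E, Rdiv; rewrite !Rmult_assoc, (Rmult_comm (exp _)).
    assert (H2 : 0 < / 2 ^ m) by (apply Rinv_0_lt_compat, pow_lt; lra).
    apply Rmult_le_compat_l; trivial; apply Rmult_le_compat_l; [lra|].
    apply exp_nondecreasing; now apply Rmult_le_compat_l. }
  assert (Hm : exists m, E / 2 ^ m < eps / 3).
  { apply NNPP; intros Hn.
    assert (eps / 3 <= 0); [|lra].
    apply (Rle_of_le_geometric _ E); intros m; apply Rnot_lt_le; intros h.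
    apply Hn; now exists m. }
  destruct Hm as [m Hm].
  pose proof (continuous_it m s) as Hcm; apply continuity_pt_filterlim in Hcm.
  destruct (Hcm (eps / 3)) as [e [He Hce]]; [lra|].
  exists (Rmin e 1); split; [apply Rmin_glb_lt; lra|].
  intros r [Hr1 Hr2]; simpl in *; unfold R_dist in *.
  assert (Hre : Rabs (r - s) < e) by (pose proof (Rmin_l e 1); lra).
  assert (HrS : Rabs r <= S).
  { replace r with (s + (r - s)) by ring; unfold S.
    eapply Rle_trans; [apply Rabs_triang|]; pose proof (Rmin_r e 1); lra. }
  specialize (Hce r (conj Hr1 Hre)).
  pose proof (HE m r HrS) as h1.
  assert (h2 : Rabs (phi s - it m s) <= E / 2 ^ m)
    by (apply HE; unfold S; lra).
  replace (phi r - phi s) with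
    ((phi r - it m r) + ((it m r - it m s) + - (phi s - it m s))) by ring.
  eapply Rle_lt_trans; [apply Rabs_triang|].
  pose proof (Rabs_triang (it m r - it m s) (- (phi s - it m s))) as h3.
  rewrite Rabs_Ropp in h3; lra. }
assert (Hfix : forall s, step phi s = phi s).
{ intros s; destruct (Hphi (Rabs s) (Rabs_pos s)) as [K [HK0 HK]].
  set (E := K * exp (L (Rabs s) * Rabs s)).
  assert (Hle : Rabs (step phi s - phi s) <= 0).
  { apply (Rle_of_le_geometric _ E); intros m.
    pose proof (step_contracts phi (it m) (K / 2 ^ m) (Rabs s) Hc
      (continuous_it m)
      (Rdiv_le_0_compat K (2 ^ m) HK0 (pow_lt 2 m Rlt_0_2)) (Rabs_pos s)
      (HK m) s (Rle_refl _)) as h1.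
    pose proof (HK (Datatypes.S m) s (Rle_refl _)) as h2.
    replace (step phi s - phi s) with
      ((step phi s - step (it m) s) + - (phi s - it (Datatypes.S m) s))
      by (unfold it; simpl; ring).
    eapply Rle_trans; [apply Rabs_triang|]; rewrite Rabs_Ropp.
    replace (E / 2 ^ m) with
      (K / 2 ^ m / 2 * exp (L (Rabs s) * Rabs s)
       + K / 2 ^ Datatypes.S m * exp (L (Rabs s) * Rabs s)).
    - lra.
    - unfold E; simpl; field; apply pow_nonzero; lra. }
  apply Rminus_diag_uniq, NNPP; intros h; apply Rabs_pos_lt in h; lra. }
exists phi; split; [|split]; trivial.
{ rewrite <- Hfix; apply RInt_point_R. }
intros s; apply is_derive_ext with (step phi); trivial.
now apply derive_step.
Qed.

Lemma frame_exists : exists x y p q, frame A B x y p q /\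
  x 0 = 0 /\ y 0 = d /\ p 0 = 1 /\ q 0 = 0.
Proof.
destruct picard_solution as [phi [Hc [Hphi0 Hphi]]].
exists (xf phi), (yf phi), (fun s => cos (phi s)), (fun s => sin (phi s)).
split; [|rewrite Hphi0, cos_0, sin_0; unfold xf, yf; rewrite !RInt_point_R;
         repeat split; ring].
intros s k; change k with (kf phi s); specialize (Hphi s).
split; [|split; [|split; [|split]]].
- now apply derive_xf.
- now apply derive_yf.
- generalize dependent (kf phi s); intros; derive_tac; ring.
- generalize dependent (kf phi s); intros; derive_tac; ring.
- pose proof (sin2_cos2 (phi s)); unfold Rsqr in *; lra.
Qed.

End Picard.

(** * The flow *)

(** A two-sided derivative restricts to the half-line because the filter there is finer. *)
Lemma time_derive_pair (f : R -> C) (t a b : R) :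
  0 <= t -> is_derive (fun s => fst (f s)) t a ->
  is_derive (fun s => snd (f s)) t b -> is_time_derive f t (a, b).
Proof.
intros Ht Ha Hb.
assert (Hf : filterdiff (K := R_AbsRing) (U := R_NormedModule)
   (V := C_R_NormedModule) f (locally t) (fun h => scal h ((a, b) : C))).
{ apply filterdiff_ext with (fun s => (fst (f s), snd (f s)) : C_R_NormedModule).
  { intros s; symmetry; apply surjective_pairing. }
  apply filterdiff_ext_lin with
    (fun h : R_NormedModule => (scal h a, scal h b) : C_R_NormedModule).
  2: { now intros. }
  apply (filterdiff_comp_2 (K := R_AbsRing) (T := R_NormedModule)
    (U := R_NormedModule) (V := R_NormedModule) (W := C_R_NormedModule)
    (fun s => fst (f s)) (fun s => snd (f s))
    (fun u v => (u, v)) (fun h => scal h a) (fun h => scal h b)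
    (fun u v => (u, v))); [exact Ha | exact Hb |].
  apply filterdiff_ext with (fun z => z); [now intros []|].
  apply filterdiff_ext_lin with (fun z => z); [apply filterdiff_id | now intros []]. }
destruct Hf as [Hlin Hdom]; split; trivial.
intros s Hs.
(* The differential is required at every limit of the restricted filter. Since [t >= 0] itself
   belongs to the half-line, [t] is the only limit. *)
assert (s = t) as ->.
{ apply NNPP; intros h.
  assert (Hd : 0 < Rabs (t - s)) by (apply Rabs_pos_lt; lra).
  specialize (Hs (ball s (mkposreal _ Hd)) (locally_ball s _)).
  apply locally_singleton in Hs; specialize (Hs Ht).
  change (Rabs (t - s) < Rabs (t - s)) in Hs; lra. }
intros eps.
apply (filter_le_within (fun s => 0 <= s)).
apply Hdom; now intros P.
Qed.

(** Put lambda = al + i be; the last two conditions say lambda' conj(lambda) = B + iA. The normal of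
    lambda X is lambda N / |lambda|, so the normal velocity is <(B + iA) X, N> / |lambda| = (B <X,N>
    + A <X,T>) / |lambda| = k / |lambda|, the curvature of the dilated curve. *)
Lemma similarity_flow (A B : R) (X : R -> C) (al be : R -> R) :
  solution A B X -> al 0 = 1 -> be 0 = 0 ->
  (forall t, 0 <= t -> 0 < al t ^ 2 + be t ^ 2 /\
     exists al' be', is_derive al t al' /\ is_derive be t be' /\
       al' * al t + be' * be t = B /\ be' * al t - al' * be t = A) ->
  curve_shortening_flow X (fun u t => (((al t, be t) : C) * X u)%C).
Proof.
intros HX Hal0 Hbe0 Hflow.
destruct (solution_frame A B X HX) as [x [y [p [q [H ->]]]]].
split.
{ intros u; rewrite Hal0, Hbe0; apply Cmult_1_l. }
intros t Ht; destruct (Hflow t Ht) as [Hr2 [al' [be' [Hal [Hbe [HBt HAt]]]]]].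
set (r := sqrt (al t ^ 2 + be t ^ 2)).
assert (Hr : 0 < r) by now apply sqrt_lt_R0.
assert (Hrr : r * r = al t ^ 2 + be t ^ 2) by (apply sqrt_sqrt; lra).
set (c := fun u => (((al t, be t) : C) * (x u, y u))%C).
set (P := fun u => (al t * p u - be t * q u) / r).
set (Q := fun u => (be t * p u + al t * q u) / r).
set (k := fun u => A * tau x y p q u + B * nu x y p q u).
assert (HPQ : forall u, is_derive P u (- (k u * Q u)) /\
                        is_derive Q u (k u * P u)).
{ intros u; destruct (H u) as [_ [_ [hp [hq _]]]].
  change (A * tau x y p q u + B * nu x y p q u) with (k u) in hp, hq.
  clearbody k; unfold P, Q; split; derive_tac; field; lra. }
destruct HX as [[HXs HYs] _].
assert (Hgeo : forall u, Cmod (deriveC c u) = r /\ tangent c u = (P u, Q u) /\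
   normal c u = (- Q u, P u) /\
   curvature c u = (k u * P u * P u - - (k u * Q u) * Q u) / r).
{ apply (curve_geometry c r P Q (fun u => - (k u * Q u)) (fun u => k u * P u));
    trivial.
  - intros u; destruct (H u) as [hx [hy _]].
    apply is_derive_ext with (fun v => al t * x v - be t * y v); [now intros|].
    unfold P; derive_tac; field; lra.
  - intros u; destruct (H u) as [hx [hy _]].
    apply is_derive_ext with (fun v => al t * y v + be t * x v); [now intros|].
    unfold Q; derive_tac; field; lra.
  - intros u; apply HPQ.
  - intros u; apply HPQ.
  - intros u; destruct (H u) as [_ [_ [_ [_ hu]]]].
    replace (P u ^ 2 + Q u ^ 2) with
      ((al t ^ 2 + be t ^ 2) * (p u ^ 2 + q u ^ 2) / (r * r))
      by (unfold P, Q; field; lra).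
    rewrite hu, Hrr; field; lra. }
split.
- split; [split|].
  + replace (fun u => Re (c u)) with (fun u => al t * x u + - be t * y u).
    * now apply smooth_fun_linear.
    * apply functional_extensionality; intros u; unfold c, Re, Cmult; simpl; ring.
  + replace (fun u => Im (c u)) with (fun u => al t * y u + be t * x u).
    * now apply smooth_fun_linear.
    * apply functional_extensionality; intros u; unfold c, Im, Cmult; simpl; ring.
  + intros u Hu; destruct (Hgeo u) as [h _]; fold c in Hu.
    rewrite Hu, Cmod_0 in h; lra.
- intros u; exists (al' * x u - be' * y u, al' * y u + be' * x u); split.
  + apply time_derive_pair; trivial; unfold Cmult; simpl; derive_tac; ring.
  + fold c; destruct (Hgeo u) as [_ [_ [-> ->]]].
    destruct (H u) as [_ [_ [_ [_ hu]]]].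
    transitivity (k u / r).
    * unfold k, tau, nu; rewrite <- HBt, <- HAt.
      unfold dot, Cmult, Cconj, Re, P, Q; simpl; field; lra.
    * replace ((k u * P u * P u - - (k u * Q u) * Q u) / r) with
        (k u * (al t ^ 2 + be t ^ 2) * (p u ^ 2 + q u ^ 2) / (r * r * r))
        by (unfold P, Q; field; lra).
      rewrite hu, <- Hrr; field; lra.
Qed.

(** * Uniqueness up to rotation and reparametrization, and the theorem *)

Lemma Cn_id (n : nat) : Cn n (fun u => u).
Proof.
destruct n as [|n]; [easy|].
exists (fun _ => 1); split; [intros u; apply (is_derive_id u) | apply Cn_const].
Qed.

Lemma diffeo_affine (a b : R) : b * b = 1 -> diffeo (fun u => a + b * u).
Proof.
intros Hb.
assert (Hs : forall c e, smooth_fun (fun u => c + e * u)).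
{ intros c e; apply smooth_fun_Cn; intros n.
  apply Cn_plus; [|apply Cn_mult; [|apply Cn_id]]; apply Cn_const. }
split; [apply Hs|].
exists (fun u => - (b * a) + b * u); split; [apply Hs|]; split; intros u.
- transitivity (b * b * u); [ring | rewrite Hb; ring].
- transitivity (a - b * b * a + b * b * u); [ring | rewrite Hb; ring].
Qed.

(** Here [b] is 1 or -1, the direction in which the second curve is traversed from its parameter
    [a]. The reparametrization inverts s -> a + b s, and [b] is its own inverse. *)
Lemma frame_same (A B : R) (x1 y1 p1 q1 x2 y2 p2 q2 : R -> R) (a b : R) :
  frame A B x1 y1 p1 q1 ->
  frame A B (fun s => x2 (a + b * s)) (fun s => y2 (a + b * s)) p2 q2 ->
  b * b = 1 ->
  tau x1 y1 p1 q1 0 = tau (fun s => x2 (a + b * s)) (fun s => y2 (a + b * s)) p2 q2 0 ->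
  nu x1 y1 p1 q1 0 = nu (fun s => x2 (a + b * s)) (fun s => y2 (a + b * s)) p2 q2 0 ->
  same_up_to_rotation_reparam (fun s => (x1 s, y1 s)) (fun s => (x2 s, y2 s)).
Proof.
intros H1 H2 Hb Ht Hn.
destruct (frame_unique A B _ _ _ _ _ _ _ _ 0 H1 H2 Ht Hn)
  as [c [d [Hcd [_ [_ Hs]]]]].
destruct (unit_angle c d Hcd) as [th [Hc Hd]].
exists th, (fun u => - (b * a) + b * u); split; [now apply diffeo_affine|].
intros u; destruct (Hs (- (b * a) + b * u)) as [hx hy].
replace (a + b * (- (b * a) + b * u)) with u in hx, hy.
- rewrite hx, hy, Hc, Hd; unfold expi, Cmult; simpl; f_equal; ring.
- transitivity (a - b * b * a + b * b * u); [rewrite Hb; ring | ring].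
Qed.

Lemma frame_ext (A B : R) (x1 y1 p1 q1 x2 y2 p2 q2 : R -> R) :
  (forall s, x1 s = x2 s) -> (forall s, y1 s = y2 s) ->
  (forall s, p1 s = p2 s) -> (forall s, q1 s = q2 s) ->
  frame A B x1 y1 p1 q1 -> frame A B x2 y2 p2 q2.
Proof.
intros hx hy hp hq; apply functional_extensionality in hx, hy, hp, hq.
now rewrite hx, hy, hp, hq.
Qed.

Theorem theorem3p1 :
  forall A B : R, A <> 0 -> 0 <= B ->
  (forall X : R -> C, solution A B X ->
     properly_embedded X /\
     exists s0 : R,
       unique (closest X) s0 /\
       forall Y : R -> C, is_arm X s0 Y ->
         distance_increases_to_infinity Y /\
         infinite_total_curvature Y /\
         spirals_infinitely Y /\
         is_lim (curvature Y) p_infty 0 /\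
         growing_direction Y ((B + Ci * A) / sqrt (A ^ 2 + B ^ 2))%C)
  /\
  (forall d : R, 0 <= d ->
     exists X : R -> C,
       (solution A B X /\ min_dist X d) /\
       forall Y : R -> C, solution A B Y -> min_dist Y d ->
         same_up_to_rotation_reparam X Y)
  /\
  (B = 0 ->
     forall X : R -> C, solution A B X ->
       curve_shortening_flow X (fun u t => (expi (A * t) * X u)%C))
  /\
  (0 < B ->
     forall X : R -> C, solution A B X ->
       curve_shortening_flow X
         (fun u t =>
            (sqrt (2 * B * t + 1)
             * expi (A / (2 * B) * ln (2 * B * t + 1)) * X u)%C)).
Proof.
intros A B HA HB; split; [|split; [|split]].
- intros X HX; destruct (solution_frame A B X HX) as [x [y [p [q [H ->]]]]].
  destruct (system_closest_point A B _ _ HA HB (frame_system A B x y p q H))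
    as [a Ha].
  split; [now apply (curve_properly_embedded A B x y p q a)|].
  exists a; split; [now apply (curve_closest A B x y p q a)|].
  assert (Harm : forall x y p q, frame A B x y p q -> tau x y p q 0 = 0 ->
    let Y := (fun r => (x r, y r)) : R -> C in
    distance_increases_to_infinity Y /\ infinite_total_curvature Y /\
    spirals_infinitely Y /\ is_lim (curvature Y) p_infty 0 /\
    growing_direction Y ((B + Ci * A) / sqrt (A ^ 2 + B ^ 2))%C).
  { clear - HA HB; intros x y p q H H0 Y.
    split; [|split; [|split; [|split]]].
    - now apply (arm_distance A B x y p q).
    - now apply (arm_total_curvature A B x y p q).
    - now apply (arm_spirals A B x y p q).
    - now apply (arm_curvature_limit A B x y p q).
    - now apply (arm_direction A B x y p q). }
  intros Y [-> | ->].
  + apply (Harm _ _ _ _ (frame_shift A B x y p q H a)).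
    unfold tau in *; now rewrite Rplus_0_r.
  + apply (Harm _ _ _ _ (frame_reverse A B x y p q H a)).
    unfold tau in *; rewrite Rminus_0_r; lra.
- intros d Hd.
  destruct (frame_exists A B d) as [x [y [p [q [H [Hx0 [Hy0 [Hp0 Hq0]]]]]]]].
  assert (Ht0 : tau x y p q 0 = 0)
    by (unfold tau; rewrite Hx0, Hq0; ring).
  assert (Hn0 : nu x y p q 0 = d)
    by (unfold nu; rewrite Hx0, Hy0, Hp0; ring).
  exists (fun s => (x s, y s)); split.
  + split; [apply (frame_solution A B x y p q H)|].
    exists 0; split; [now apply (curve_closest A B x y p q 0)|].
    rewrite Cmod_pair, Hx0, Hy0.
    transitivity (sqrt (d ^ 2)); [f_equal; ring | now apply sqrt_pow2].
  + intros Y HY [s1 [Hs1 Hd1]].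
    destruct (solution_frame A B Y HY) as [x' [y' [p' [q' [H' ->]]]]].
    destruct (system_closest_point A B _ _ HA HB
      (frame_system A B x' y' p' q' H')) as [a Ha].
    assert (Has : a = s1)
      by now apply (curve_closest A B x' y' p' q' a HB H' Ha).
    rewrite <- Has, Cmod_pair, (frame_dist A B x' y' p' q' H'), Ha in Hd1.
    assert (Hnd : (nu x' y' p' q' a - d) * (nu x' y' p' q' a + d) = 0).
    { assert (h : 0 <= 0 ^ 2 + nu x' y' p' q' a ^ 2)
        by (pose proof (pow2_ge_0 (nu x' y' p' q' a)); lra).
      apply sqrt_sqrt in h; rewrite Hd1 in h; lra. }
    (* At its closest point the other curve has [nu] equal to [d] or [- d]. In the second case it is
       traversed backwards, which changes the sign of [nu]. *)
    apply Rmult_integral in Hnd; destruct Hnd as [Hnd | Hnd].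
    * apply (frame_same A B x y p q x' y' (fun s => p' (a + s))
        (fun s => q' (a + s)) a 1); trivial; [| ring | |].
      -- apply (frame_ext A B _ _ _ _ _ _ _ _) with
           (5 := frame_shift A B x' y' p' q' H' a);
           intros s; f_equal; ring.
      -- rewrite Ht0; unfold tau in *.
         replace (a + 1 * 0) with a by ring; rewrite Rplus_0_r; lra.
      -- rewrite Hn0; unfold nu in *.
         replace (a + 1 * 0) with a by ring; rewrite Rplus_0_r; lra.
    * apply (frame_same A B x y p q x' y' (fun s => - p' (a - s))
        (fun s => - q' (a - s)) a (-1)); trivial; [| ring | |].
      -- apply (frame_ext A B _ _ _ _ _ _ _ _) with
           (5 := frame_reverse A B x' y' p' q' H' a);
           intros s; trivial; f_equal; ring.
      -- rewrite Ht0; unfold tau in *.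
         replace (a + -1 * 0) with a by ring; rewrite Rminus_0_r; lra.
      -- rewrite Hn0; unfold nu in *.
         replace (a + -1 * 0) with a by ring; rewrite Rminus_0_r; lra.
- intros -> X HX.
  apply (similarity_flow A 0 X (fun t => cos (A * t)) (fun t => sin (A * t)));
    trivial.
  + now rewrite Rmult_0_r, cos_0.
  + now rewrite Rmult_0_r, sin_0.
  + intros t _; pose proof (sin2_cos2 (A * t)) as h; unfold Rsqr in h; split.
    { lra. }
    exists (- (A * sin (A * t))), (A * cos (A * t)); split; [|split; [|split]].
    * auto_derive; trivial; ring.
    * auto_derive; trivial; ring.
    * ring.
    * transitivity (A * (sin (A * t) * sin (A * t) + cos (A * t) * cos (A * t)));
        [ring | rewrite h; ring].
- intros HB' X HX.
  (* For lambda = g exp(i f) one has lambda' conj(lambda) = g g' + i g^2 f', so the requirements are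
     g g' = B and g^2 f' = A. *)
  set (g := fun t => sqrt (2 * B * t + 1)).
  set (f := fun t => A / (2 * B) * ln (2 * B * t + 1)).
  match goal with |- curve_shortening_flow _ ?F => replace F with
    (fun u t => ((((g t * cos (f t))%R, (g t * sin (f t))%R) : C) * X u)%C) end.
  2: { apply functional_extensionality; intros u.
       apply functional_extensionality; intros t; f_equal.
       unfold f, g, expi, Cmult, RtoC; simpl; f_equal; ring. }
  assert (Hlin : 2 * B * 0 + 1 = 1) by ring.
  apply (similarity_flow A B X (fun t => g t * cos (f t))
    (fun t => g t * sin (f t))); trivial.
  + unfold f, g; rewrite Hlin, ln_1, sqrt_1, Rmult_0_r, cos_0; ring.
  + unfold f; rewrite Hlin, ln_1, Rmult_0_r, sin_0; ring.
  + intros t Ht.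
    assert (Hw : 0 < 2 * B * t + 1)
      by (assert (0 <= 2 * B * t) by (apply Rmult_le_pos; lra); lra).
    assert (Hg0 : 0 < g t) by now apply sqrt_lt_R0.
    assert (Hgg : g t * g t = 2 * B * t + 1) by (apply sqrt_sqrt; lra).
    pose proof (sin2_cos2 (f t)) as h; unfold Rsqr in h.
    assert (Hg : is_derive g t (B / g t)).
    { unfold g in *; auto_derive; [lra|]; field; lra. }
    assert (Hf : is_derive f t (A / (g t * g t))).
    { rewrite Hgg; unfold f; auto_derive; [lra|]; field; lra. }
    clearbody f g; split.
    * replace ((g t * cos (f t)) ^ 2 + (g t * sin (f t)) ^ 2)
        with (g t * g t * (sin (f t) * sin (f t) + cos (f t) * cos (f t))) by ring.
      rewrite h, Hgg; lra.
    * exists (B / g t * cos (f t) - g t * (A / (g t * g t)) * sin (f t)).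
      exists (B / g t * sin (f t) + g t * (A / (g t * g t)) * cos (f t)).
      split; [|split; [|split]].
      -- derive_tac; field; lra.
      -- derive_tac; field; lra.
      -- transitivity (B * (sin (f t) * sin (f t) + cos (f t) * cos (f t)));
           [field; lra | rewrite h; ring].
      -- transitivity (A * (sin (f t) * sin (f t) + cos (f t) * cos (f t)));
           [field; lra | rewrite h; ring].
Qed.
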